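(* Let $\omega\in\Omega^1(a)$ be such that $i_R\omega=0$ and $\omega\wedge d\omega=0$. With the actions of $S$ on $T_{\omega\vartriangle}$ and $\Omega^r_{\omega\vartriangle}$ and the maps $\omega\vartriangle$ defined in the context, the sequence $$C^\bullet_{\omega\vartriangle}(\omega):\quad T_{\omega\vartriangle}\xrightarrow{\ \omega\vartriangle\ }\Omega^1_{\omega\vartriangle}\xrightarrow{\ \omega\vartriangle\ }\Omega^3_{\omega\vartriangle}\xrightarrow{\ \omega\vartriangle\ }\cdots$$ is a complex of $S$-modules, and the $S$-modules $\Omega^r_{\omega\vartriangle}$ and $T_{\omega\vartriangle}$ are finitely generated.
   Context: $S=\mathbb C[x_1,\dots,x_n]$ and $\Omega=\bigoplus_{r\ge0}\Omega^r$ is the exterior algebra of (Kähler) differential forms of $S$ over $\mathbb C$. Each $\Omega^r$ is graded, $\Omega^r=\bigoplus_{b\ge0}\Omega^r(b)$, with each $x_i$ and each $dx_i$ of degree $1$; $S(c)$ is the space of homogeneous polynomials of degree $c$. $T=(\Omega^1)^*$ is the module of polynomial vector fields, graded by giving each $\frac{\partial}{\partial x_i}$ degree $-1$, with homogeneous components $T(b)$. $d$ is the exterior differential, $i_X$ is contraction with a vector field $X$, $R=\sum_i x_i\frac{\partial}{\partial x_i}$ is the radial vector field. Put $\kappa(r)=\frac{r+1}{2}$. For $\tau\in\Omega^r$ define $\omega\vartriangle\tau=\omega\wedge d\tau+\kappa(r)\,d\omega\wedge\tau\in\Omega^{r+2}$, and for $X\in T$ define $\omega\vartriangle X=\mathcal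 L_X(\omega)=i_Xd\omega+di_X\omega\in\Omega^1$. $\Omega^r_{\omega\vartriangle}$ is the $\mathbb C$-vector space $\bigoplus_{b>\kappa(r)a}\Omega^r(b)$ with the action of $S$ given, for $f\in S(c)$ and $\tau\in\Omega^r(b)$, by $$f\cdot_{\vartriangle}\tau=\frac{1}{b+c-\kappa(r)a}\Big[\big(b-\kappa(r)a\big)f\tau+df\wedge i_R\tau\Big].$$ $T_{\omega\vartriangle}$ is the $\mathbb C$-vector space $\bigoplus_{b\ge1}T(b)$ with the action of $S$ given, for $f\in S(c)$ and $X\in T(b)$, by $f\cdot_{\vartriangle}X=\frac{b}{b+c}\,fX$. The actions are extended additively to non-homogeneous elements. *)

(* Defs.v *)
From HB Require Import structures.
From mathcomp Require Import all_boot all_order all_algebra.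
From mathcomp Require Import reals.
From mathcomp.real_closed Require Import complex.
From mathcomp.multinomials Require Import mpoly.

Set Implicit Arguments.
Unset Strict Implicit.
Unset Printing Implicit Defensive.

Import Order.TTheory GRing.Theory Num.Theory.
Local Open Scope ring_scope.

(* The module Omega of polynomial differential forms in n variables is free
   over {mpoly F[n]} on the dx_I = dx_{i_1} /\ ... /\ dx_{i_r}, where
   I = {i_1 < ... < i_r}; a form is its family of coefficients on the dx_I.
   Likewise X : vectField F n stands for \sum_i (X i) d/dx_i. *)
Definition diffForm (F : numFieldType) (n : nat) := {ffun {set 'I_n} -> {mpoly F[n]}}.
Definition vectField (F : numFieldType) (n : nat) := {ffun 'I_n -> {mpoly F[n]}}.

Section Calculus.
Variables (F : numFieldType) (n : nat).
Implicit Types (f : {mpoly F[n]}) (s t w : diffForm F n) (X : vectField F n).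
Implicit Types (I J K : {set 'I_n}).

Definition fscale f t : diffForm F n := [ffun I => f * t I].
Definition vscale f X : vectField F n := [ffun i => f * X i].

(* dx_I /\ dx_J = (-1)^(inversions I J) dx_(I :|: J) for disjoint I and J. *)
Definition inversions I J : nat :=
  #|[set p : 'I_n * 'I_n | [&& p.1 \in I, p.2 \in J & (p.2 < p.1)%N]]|.

Definition wedge s t : diffForm F n :=
  [ffun K : {set 'I_n} => \sum_(I : {set 'I_n} | I \subset K)
     (-1) ^+ inversions I (K :\: I) * (s I * t (K :\: I))].

Definition dx I : diffForm F n := [ffun J => (J == I)%:R].

Definition dfun f : diffForm F n := \sum_(i < n) fscale (mderiv i f) (dx [set i]).

Definition extd t : diffForm F n := \sum_(I : {set 'I_n}) wedge (dfun (t I)) (dx I).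

(* i_X (dx_{i_1} /\ ... /\ dx_{i_r}) is the sum over k of
   (-1)^(k-1) X_{i_k} times the product of the other dx_{i_l}, in order. *)
Definition contract X t : diffForm F n :=
  [ffun J : {set 'I_n} => \sum_(i < n | i \notin J)
     (-1) ^+ #|[set j in J | (j < i)%N]| * (X i * t (i |: J))].

Definition radial : vectField F n := [ffun i => 'X_i].

(* The homogeneous component of degree b; each x_i and dx_i has degree 1. *)
Definition fcomp (b : nat) t : diffForm F n :=
  [ffun I : {set 'I_n} =>
     if (#|I| <= b)%N then pihomog mdeg (b - #|I|) (t I) else 0].

(* All components of degree >= fsize t vanish. *)
Definition fsize t : nat := \max_(I : {set 'I_n}) (msize (t I) + #|I|)%N.

(* d/dx_i has degree -1: X is of degree b when the X i are of degree b + 1. *)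
Definition vcomp (b : int) X : vectField F n :=
  [ffun i => if b + 1 is Posz e then pihomog mdeg e (X i) else 0].

Definition vsize X : nat := \max_(i < n) msize (X i).

Definition Omega (r : nat) t : Prop := forall I, #|I| != r -> t I = 0.

Definition Omega_hom (r b : nat) t : Prop := Omega r t /\ fcomp b t = t.

Definition kappa (r : nat) : F := (r%:R + 1) / 2.

Definition tri (r : nat) w t : diffForm F n :=
  wedge w (extd t) + kappa r *: wedge (extd w) t.

Definition triT w X : diffForm F n := contract X (extd w) + extd (contract X w).

(* The carriers of the two modules, as subsets of all forms and all vector
   fields; a is the degree of w. *)
Definition OmegaTri (a r : nat) t : Prop :=
  Omega r t /\
  forall b : nat, ~~ (kappa r * a%:R < b%:R) -> fcomp b t = 0.

Definition TTri X : Prop := forall b : int, b < 1 -> vcomp b X = 0.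

Definition actOmega_hom (a r c b : nat) f t : diffForm F n :=
  (b%:R + c%:R - kappa r * a%:R)^-1 *:
    ((b%:R - kappa r * a%:R) *: fscale f t
     + wedge (dfun f) (contract radial t)).

Definition actOmega (a r : nat) f t : diffForm F n :=
  \sum_(c < msize f) \sum_(b < fsize t | kappa r * a%:R < b%:R)
    actOmega_hom a r c b (pihomog mdeg c f) (fcomp b t).

Definition actT_hom (c b : nat) f X : vectField F n :=
  (b%:R / (b%:R + c%:R) : F) *: vscale f X.

Definition actT f X : vectField F n :=
  \sum_(c < msize f) \sum_(1 <= b < vsize X)
    actT_hom c b (pihomog mdeg c f) (vcomp b%:Z X).

End Calculus.

Arguments radial F n : clear implicits.
Arguments OmegaTri F n a r t : clear implicits.
Arguments TTri F n X : clear implicits.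
Arguments actOmega F n a r f t : clear implicits.
Arguments actT F n f X : clear implicits.

(* Modules are given as an additive subgroup M of an ambient group V, with an
   action act that is only meaningful on M; the last four fields of is_module
   are the axioms of lmodType. *)
Record is_module (A : pzRingType) (V : zmodType) (M : V -> Prop)
    (act : A -> V -> V) : Prop := IsModule {
  module_0 : M 0;
  module_B : forall x y, M x -> M y -> M (x - y);
  module_act : forall a x, M x -> M (act a x);
  module_actA : forall a b x, M x -> act a (act b x) = act (a * b) x;
  module_act1 : forall x, M x -> act 1 x = x;
  module_actDr : forall a x y, M x -> M y -> act a (x + y) = act a x + act a y;
  module_actDl : forall a b x, M x -> act (a + b) x = act a x + act b x
}.

Record is_module_hom (A : pzRingType) (V W : zmodType)
    (M : V -> Prop) (actM : A -> V -> V) (N : W -> Prop) (actN : A -> W -> W)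
    (phi : V -> W) : Prop := IsModuleHom {
  module_hom_in : forall x, M x -> N (phi x);
  module_homD : forall x y, M x -> M y -> phi (x + y) = phi x + phi y;
  module_homZ : forall a x, M x -> phi (actM a x) = actN a (phi x)
}.

Definition fin_gen (A : pzRingType) (V : zmodType) (M : V -> Prop)
    (act : A -> V -> V) : Prop :=
  exists (k : nat) (g : 'I_k -> V),
    (forall i, M (g i)) /\
    (forall x, M x -> exists a : 'I_k -> A, x = \sum_(i < k) act (a i) (g i)).

(* Main.v *)
(* The operators extl i = dx_i /\ -, intl i = contraction with d/dx_i and the
   coefficientwise pd i = d/dx_i satisfy the canonical anticommutation
   relations and, with multiplication by polynomials, generate wedge, d and
   i_X; the Leibniz rules, d^2 = 0 and Cartan's formula i_R d + d i_R = b on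
   forms of degree b follow from these relations.

   Put m = b - kappa(r) a for t in Omega^r(b). The twisted action satisfies
   i_R (f . t) = f i_R t, which gives associativity, and S-linearity of the
   differentials comes from i_R (L_X w) = b i_X w and
   i_R (w tri t) = w tri (i_R t) - m w /\ t.

   Finite generation: in degree b + 1 > r + 1, Euler's identity gives
   t = \sum_i x_i t_i. Then z = t - \sum_i x_i . t_i is killed by i_R, so
   z = i_R s with s = dz / (b + 1) = \sum_i x_i s_i, and
   x_i . (i_R s_i) = m / (m + 1) x_i (i_R s_i). So t is a combination of the
   x_i . y_i with y_i of degree b, and the monomial forms of bounded degree
   generate. *)

Require Import Defs.
From mathcomp Require Import all_boot all_order all_algebra.
From mathcomp Require Import reals.
From mathcomp.real_closed Require Import complex.
From mathcomp.multinomials Require Import mpoly.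
From HB Require Import structures.
From mathcomp Require Import ring zify.
Import GRing.Theory.
Local Open Scope ring_scope.
Set Implicit Arguments.
Unset Strict Implicit.
Unset Printing Implicit Defensive.
Import Order.TTheory Num.Theory.

(** * Creation and annihilation operators *)

Section ExteriorAlgebra.
Variables (F : numFieldType) (n : nat).
Implicit Types (f g : {mpoly F[n]}) (s t u : diffForm F n) (X Y : vectField F n).
Implicit Types (i j : 'I_n) (I J K : {set 'I_n}).

(* The exponent of the sign in dx_i /\ dx_K and in the contraction of
   dx_(i |: K) with d/dx_i; it does not depend on whether i is in K. *)
Definition below i K : nat := #|[set j in K | (j < i)%N]|.

Lemma below_sum i K : below i K = (\sum_(j in K) (j < i))%N.
Proof.
rewrite /below -sum1_card big_mkcond [RHS]big_mkcond /=.
by apply: eq_bigr => j _; rewrite inE; case: (j \in K) => //=; case: (j < i)%N.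
Qed.

Lemma belowU1 i j K : j \notin K -> below i (j |: K) = ((j < i) + below i K)%N.
Proof. by move=> jK; rewrite !below_sum big_setU1. Qed.

Lemma belowD1 i j K : j \in K -> below i K = ((j < i) + below i (K :\ j))%N.
Proof. by move=> jK; rewrite !below_sum (big_setD1 j). Qed.

Lemma belowDS i I K : I \subset K -> below i K = (below i I + below i (K :\: I))%N.
Proof.
move=> IK; rewrite !below_sum (big_setID I) /=.
by rewrite (setIidPr IK).
Qed.

Definition extl i t : diffForm F n :=
  [ffun K : {set 'I_n} => if i \in K then (-1) ^+ below i K * t (K :\ i) else 0].

Definition intl i t : diffForm F n :=
  [ffun J : {set 'I_n} => if i \in J then 0 else (-1) ^+ below i J * t (i |: J)].

Definition pd i t : diffForm F n := [ffun J => mderiv i (t J)].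

Lemma fscale_is_linear f : linear (@fscale F n f).
Proof. by move=> c s t; apply/ffunP => K; rewrite !ffunE mulrDr scalerAr. Qed.
HB.instance Definition _ f :=
  GRing.isLinear.Build F (diffForm F n) (diffForm F n) _ (@fscale F n f) (@fscale_is_linear f).

Lemma extl_is_linear i : linear (extl i).
Proof.
move=> c s t; apply/ffunP => K; rewrite !ffunE.
by case: ifP; rewrite ?scaler0 ?addr0 // mulrDr scalerAr.
Qed.
HB.instance Definition _ i :=
  GRing.isLinear.Build F (diffForm F n) (diffForm F n) _ (extl i) (@extl_is_linear i).

Lemma intl_is_linear i : linear (intl i).
Proof.
move=> c s t; apply/ffunP => K; rewrite !ffunE.
by case: ifP; rewrite ?scaler0 ?addr0 // mulrDr scalerAr.
Qed.
HB.instance Definition _ i :=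
  GRing.isLinear.Build F (diffForm F n) (diffForm F n) _ (intl i) (@intl_is_linear i).

Lemma pd_is_linear i : linear (pd i).
Proof. by move=> c s t; apply/ffunP => K; rewrite !ffunE mderivD mderivZ. Qed.
HB.instance Definition _ i :=
  GRing.isLinear.Build F (diffForm F n) (diffForm F n) _ (pd i) (@pd_is_linear i).

Lemma fscaleDl f g t : fscale (f + g) t = fscale f t + fscale g t.
Proof. by apply/ffunP => K; rewrite !ffunE mulrDl. Qed.

Lemma fscale0l t : fscale 0 t = 0.
Proof. by apply/ffunP => K; rewrite !ffunE mul0r. Qed.

Lemma fscale1 t : fscale 1 t = t.
Proof. by apply/ffunP => K; rewrite !ffunE mul1r. Qed.

Lemma fscaleZl c f t : fscale (c *: f) t = c *: fscale f t.
Proof. by apply/ffunP => K; rewrite !ffunE scalerAl. Qed.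

Lemma fscale_suml (T : Type) (r : seq T) (P : pred T) (G : T -> {mpoly F[n]}) t :
  fscale (\sum_(k <- r | P k) G k) t = \sum_(k <- r | P k) fscale (G k) t.
Proof.
elim/big_rec2: _ => [|k y1 y2 _ <-]; first exact: fscale0l.
exact: fscaleDl.
Qed.

Lemma fscaleA f g t : fscale f (fscale g t) = fscale (f * g) t.
Proof. by apply/ffunP => K; rewrite !ffunE mulrA. Qed.

Lemma fscaleC f g t : fscale f (fscale g t) = fscale g (fscale f t).
Proof. by rewrite !fscaleA mulrC. Qed.

Lemma extl_fscale i f t : extl i (fscale f t) = fscale f (extl i t).
Proof. by apply/ffunP => K; rewrite !ffunE; case: ifP; rewrite ?mulr0 // mulrCA. Qed.

Lemma intl_fscale i f t : intl i (fscale f t) = fscale f (intl i t).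
Proof. by apply/ffunP => K; rewrite !ffunE; case: ifP; rewrite ?mulr0 // mulrCA. Qed.

Lemma pd_fscale i f t : pd i (fscale f t) = fscale (mderiv i f) t + fscale f (pd i t).
Proof. by apply/ffunP => K; rewrite !ffunE mderivM. Qed.

Lemma mderiv_sign i k f : mderiv i ((-1) ^+ k * f) = (-1) ^+ k * mderiv i f.
Proof. by rewrite -signr_odd; case: (odd k); rewrite ?expr0 ?expr1 ?mul1r ?mulN1r ?mderivN. Qed.

Lemma pd_extl i j t : pd i (extl j t) = extl j (pd i t).
Proof.
apply/ffunP => K; rewrite !ffunE.
by case: ifP; rewrite ?mderiv0 // mderiv_sign.
Qed.

Lemma pd_intl i j t : pd i (intl j t) = intl j (pd i t).
Proof.
apply/ffunP => K; rewrite !ffunE.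
by case: ifP; rewrite ?mderiv0 // mderiv_sign.
Qed.

Lemma pdC i j t : pd i (pd j t) = pd j (pd i t).
Proof. by apply/ffunP => K; rewrite !ffunE mderiv_comm. Qed.

(** For distinct [i] and [j] exactly one of [j < i] and [i < j] holds, so removing the two indices
    in the other order changes the parity of the sign exponent. *)
Lemma extlC i j t : extl i (extl j t) = - extl j (extl i t).
Proof.
apply/ffunP => K; rewrite !ffunE !inE.
have [->|nij] := eqVneq i j; first by rewrite ?eqxx /=; case: ifP; rewrite ?mulr0 oppr0.
rewrite ?(eq_sym j) ?nij /=.
have [iK|iK] := boolP (i \in K); have [jK|jK] := boolP (j \in K);
  rewrite ?mulr0 ?oppr0 //.
rewrite [K :\ i :\ j]setDDl [K :\ j :\ i]setDDl [[set j] :|: _]setUC.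
rewrite (belowD1 i jK) (belowD1 j iK).
have : (i != j :> nat)%N by [].
by case: ltngtP => //= _ _; rewrite !exprD /=; ring.
Qed.

Lemma intlC i j t : intl i (intl j t) = - intl j (intl i t).
Proof.
apply/ffunP => K; rewrite !ffunE !inE.
have [->|nij] := eqVneq i j; first by rewrite ?eqxx /=; case: ifP; rewrite ?mulr0 oppr0.
rewrite ?(eq_sym j) ?(negPf nij) /=.
have [iK|iK] := boolP (i \in K); have [jK|jK] := boolP (j \in K);
  rewrite ?mulr0 ?oppr0 //.
rewrite setUCA (belowU1 i jK) (belowU1 j iK).
have : (i != j :> nat)%N by [].
by case: ltngtP => //= _ _; rewrite !exprD /=; ring.
Qed.

(** For [i = j] exactly one term is nonzero at each [K], with a squared sign. For distinct indices
    the terms have opposite signs by the same count as in [extlC]. *)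
Lemma intl_extl i j t : intl i (extl j t) + extl j (intl i t) = (i == j)%:R *: t.
Proof.
have sgn2 k : (-1) ^+ k * (-1) ^+ k = 1 :> {mpoly F[n]}
  by rewrite -exprD addnn -signr_odd odd_double.
apply/ffunP => K; rewrite !ffunE !inE.
have [->|nij] := eqVneq i j.
  rewrite ?eqxx /= scale1r; have [jK|jK] := boolP (j \in K).
    by rewrite (belowD1 j jK) ltnn mulrA sgn2 mul1r add0r setD1K.
  by rewrite (belowU1 j jK) ltnn mulrA sgn2 mul1r addr0 setU1K.
rewrite scale0r ?(eq_sym j) ?(negPf nij) /=.
have [iK|iK] := boolP (i \in K); have [jK|jK] := boolP (j \in K);
  rewrite ?mulr0 ?addr0 //.
have -> : (i |: K) :\ j = i |: K :\ j.
  apply/setP => k; rewrite !inE; have [->|] := eqVneq k i => //=.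
  by rewrite nij.
rewrite (belowU1 j iK) (belowD1 i jK).
have : (i != j :> nat)%N by [].
by case: ltngtP => //= _ _; rewrite !exprD /=; ring.
Qed.

Lemma intlE i j t : intl i (extl j t) = (i == j)%:R *: t - extl j (intl i t).
Proof. by rewrite -(intl_extl i j) addrK. Qed.

Lemma form_sum t : t = \sum_(I : {set 'I_n}) fscale (t I) (dx F I).
Proof.
apply/ffunP => K; rewrite sum_ffunE (bigD1 K) //= !ffunE eqxx mulr1 big1 ?addr0 //.
by move=> I /negPf IK; rewrite !ffunE eq_sym IK mulr0.
Qed.

Lemma extl_dx i K : i \in K -> dx F K = extl i ((-1) ^+ below i K *: dx F (K :\ i)).
Proof.
move=> iK; apply/ffunP => J; rewrite !ffunE.
have [iJ|iJ] := boolP (i \in J); last first.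
  by have [E|] := eqVneq J K; rewrite // -E (negPf iJ) in iK.
have [->|nJK] := eqVneq J K.
  rewrite eqxx -scalerAr mulr1 -[_ ^+ below i K]signr_odd -[_ ^+ below i K]signr_odd.
  by case: odd; rewrite ?expr0 ?scale1r //= scaleN1r opprK.
have [E|_] := eqVneq; last by rewrite scaler0 mulr0.
by case/eqP: nJK; rewrite -(setD1K iJ) E setD1K.
Qed.

(** Up to sign every [dx_K] is an iterated [extl] of the constant 1, so an identity additive in a
    form need only be checked on functions and carried through [extl]. *)
Lemma form_ind (P : diffForm F n -> Prop) :
  (forall f, P (fscale f (dx F set0))) ->
  (forall s t, P s -> P t -> P (s + t)) ->
  (forall i t, P t -> P (extl i t)) -> forall t, P t.
Proof.
move=> P0 PD PE t; rewrite (form_sum t); elim/big_ind: _ => //.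
  by rewrite -(fscale0l (dx F set0)).
(* Induction on a bound for [#|I|], with the coefficient generalized so that it can absorb the sign
   from [extl_dx]. *)
move=> I _; move: (t I); move: {2}#|I| (leqnn #|I|) => k.
elim: k I => [|k IH] I kI f; first by move: kI; rewrite leqn0 cards_eq0 => /eqP ->.
have [->//|[i iI]] := set_0Vmem I.
rewrite (extl_dx iI) -extl_fscale linearZ /= -fscaleZl; apply: (PE i); apply: IH.
by move: kI; rewrite (cardsD1 i) iI.
Qed.

(** * The wedge product and its generation by [extl] *)

Lemma inversions_sum I J : inversions I J = (\sum_(i in I) below i J)%N.
Proof.
rewrite /inversions -sum1_card.
under [RHS]eq_bigr do rewrite below_sum.
rewrite pair_big_dep /= big_mkcond [RHS]big_mkcond /=.
apply: eq_bigr => -[i j] _; rewrite inE /=.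
by case: (i \in I); case: (j \in J) => //=; case: (j < i)%N.
Qed.

Lemma wedge_is_linear s : linear (wedge s).
Proof.
move=> c t u; apply/ffunP => K; rewrite !ffunE scaler_sumr -big_split /=.
by apply: eq_bigr => I _; rewrite !ffunE !(mulrDr, scalerAr).
Qed.
HB.instance Definition _ s :=
  GRing.isLinear.Build F (diffForm F n) (diffForm F n) _ (wedge s) (@wedge_is_linear s).

Lemma wedgeDl s t u : wedge (s + t) u = wedge s u + wedge t u.
Proof.
apply/ffunP => K; rewrite !ffunE -big_split /=.
by apply: eq_bigr => I _; rewrite !ffunE !(mulrDl, mulrDr).
Qed.

Lemma wedge_fscale f s t : wedge (fscale f s) t = fscale f (wedge s t).
Proof.
apply/ffunP => K; rewrite !ffunE big_distrr /=.
by apply: eq_bigr => I _; rewrite !ffunE; ring.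
Qed.

Lemma wedge0l t : wedge 0 t = 0.
Proof. by rewrite -{1}(fscale0l 0) wedge_fscale fscale0l. Qed.

Lemma wedgeZl c s t : wedge (c *: s) t = c *: wedge s t.
Proof.
have sc u : c *: u = fscale (c *: 1) u by rewrite fscaleZl fscale1.
by rewrite !sc wedge_fscale.
Qed.

Lemma wedgeNl s t : wedge (- s) t = - wedge s t.
Proof. by rewrite -scaleN1r wedgeZl scaleN1r. Qed.

Lemma wedge_suml (T : Type) (r : seq T) (P : pred T) (G : T -> diffForm F n) t :
  wedge (\sum_(k <- r | P k) G k) t = \sum_(k <- r | P k) wedge (G k) t.
Proof.
elim/big_rec2: _ => [|k y1 y2 _ <-]; first exact: wedge0l.
exact: wedgeDl.
Qed.

Lemma wedge1 t : wedge (dx F set0) t = t.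
Proof.
apply/ffunP => K; rewrite !ffunE (bigD1 set0) ?sub0set //=.
rewrite inversions_sum big_set0 setD0 ffunE eqxx !mul1r big1 ?addr0 //.
by move=> I /andP[_ /negPf I0]; rewrite ffunE I0 mul0r mulr0.
Qed.

Lemma wedge_extl i s t : wedge (extl i s) t = extl i (wedge s t).
Proof.
apply/ffunP => K; rewrite !ffunE.
rewrite (bigID (fun I => i \in I)) /= [X in _ + X]big1 ?addr0; last first.
  by move=> I /andP[_ /negPf iI]; rewrite ffunE iI mul0r mulr0.
have [iK|iK] := boolP (i \in K); last first.
  rewrite big1 // => I /andP[/subsetP IK iI].
  by case/negP: iK; apply: IK.
rewrite big_distrr /=.
(* Only sets containing [i] contribute; they are written [i |: I] with [i] not in [I]. *)
rewrite (reindex_onto (fun I => i |: I) (fun I => I :\ i)) /=; last first.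
  by move=> I /andP[_ iI]; rewrite setD1K.
apply: eq_big => [I|I].
  rewrite !inE eqxx /= andbT subUset sub1set iK /= subsetD1.
  by congr (_ && _); apply/eqP/idP => [<-|/setU1K //]; rewrite !inE eqxx.
rewrite !inE eqxx /= andbT subUset sub1set iK /= => /andP[IK /eqP iI].
have {}iI : i \notin I by rewrite -iI !inE eqxx.
rewrite !ffunE !inE eqxx /= setU1K // setDDl.
(* The inversions with first entry [i] complete [below i (i |: I)] to [below i K]. *)
rewrite inversions_sum big_setU1 //= -inversions_sum.
rewrite (@belowDS i (i |: I) K) ?subUset ?sub1set ?iK //.
by rewrite !exprD; ring.
Qed.

Lemma wedgeA s t u : wedge s (wedge t u) = wedge (wedge s t) u.
Proof.
elim/form_ind: s => [f|s s' Hs Hs'|i s Hs].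
- by rewrite !wedge_fscale !wedge1.
- by rewrite !wedgeDl Hs Hs'.
- by rewrite !wedge_extl Hs.
Qed.

Lemma dx1E i : dx F [set i] = extl i (dx F set0).
Proof.
rewrite (@extl_dx i) ?set11 // setDv.
rewrite below_sum big_set1 ltnn expr0 scale1r; congr extl.
Qed.

Lemma wedge_dfun f t : wedge (dfun f) t = \sum_i fscale (mderiv i f) (extl i t).
Proof.
rewrite /dfun wedge_suml; apply: eq_bigr => i _.
by rewrite wedge_fscale dx1E wedge_extl wedge1.
Qed.

Lemma extdE t : extd t = \sum_i extl i (pd i t).
Proof.
rewrite /extd; under eq_bigr do rewrite wedge_dfun.
rewrite exchange_big /=; apply: eq_bigr => i _.
rewrite [in RHS](form_sum (pd i t)) linear_sum /=.
by apply: eq_bigr => I _; rewrite extl_fscale ffunE.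
Qed.

Lemma contractE X t : contract X t = \sum_i fscale (X i) (intl i t).
Proof.
apply/ffunP => J; rewrite sum_ffunE !ffunE big_mkcond /=.
apply: eq_bigr => i _; rewrite !ffunE; case: (i \in J) => /=; rewrite ?mulr0 //.
by rewrite mulrCA.
Qed.

End ExteriorAlgebra.

(** * Leibniz rules *)

Section Calculus.
Variables (F : numFieldType) (n : nat).
Implicit Types (f g p q : {mpoly F[n]}) (s t u : diffForm F n) (X Y : vectField F n).
Implicit Types (i j : 'I_n) (I J K : {set 'I_n}).

(** The grading involution. It stands for the sign (-1)^r in the Leibniz rules and lets them be
    stated for forms of mixed degree. *)
Definition sgf s : diffForm F n := [ffun I : {set 'I_n} => (-1) ^+ #|I| * s I].

Lemma sgf_is_linear : linear sgf.
Proof. by move=> c s t; apply/ffunP => K; rewrite !ffunE mulrDr scalerAr. Qed.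
HB.instance Definition _ :=
  GRing.isLinear.Build F (diffForm F n) (diffForm F n) _ sgf sgf_is_linear.

Lemma sgf_fscale f s : sgf (fscale f s) = fscale f (sgf s).
Proof. by apply/ffunP => K; rewrite !ffunE mulrCA. Qed.

Lemma sgf_extl i s : sgf (extl i s) = - extl i (sgf s).
Proof.
apply/ffunP => K; rewrite !ffunE; have [iK|_] := boolP (i \in K); last by rewrite mulr0 oppr0.
by rewrite (cardsD1 i) iK exprD; ring.
Qed.

Lemma sgf_Omega r s : Omega r s -> sgf s = (-1) ^+ r *: s.
Proof.
move=> sr; apply/ffunP => K; rewrite !ffunE.
have [->|/sr ->] := eqVneq #|K| r; last by rewrite mulr0 scaler0.
by rewrite -signr_odd -[X in X *: _]signr_odd; case: odd;
  rewrite ?expr0 ?mul1r ?scale1r // !expr1 mulN1r scaleN1r.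
Qed.

Lemma Omega_dx0 : Omega 0 (dx F (set0 : {set 'I_n})).
Proof. by move=> I I0; rewrite ffunE -cards_eq0 (negPf I0). Qed.

Lemma sgf_dx0 : sgf (dx F set0) = dx F set0.
Proof. by rewrite (sgf_Omega Omega_dx0) expr0 scale1r. Qed.

Lemma wedge_fscaler f s t : wedge s (fscale f t) = fscale f (wedge s t).
Proof.
apply/ffunP => K; rewrite !ffunE big_distrr /=.
by apply: eq_bigr => I _; rewrite !ffunE; ring.
Qed.

Lemma wedge_extlr i s t : wedge s (extl i t) = extl i (wedge (sgf s) t).
Proof.
elim/form_ind: s => [f|s s' Hs Hs'|j s Hs].
- by rewrite sgf_fscale sgf_dx0 !wedge_fscale !wedge1 extl_fscale.
- by rewrite raddfD /= !wedgeDl Hs Hs' raddfD.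
- by rewrite wedge_extl Hs extlC sgf_extl wedgeNl wedge_extl raddfN.
Qed.

Lemma form1_sum u : Omega 1 u -> u = \sum_i fscale (u [set i]) (extl i (dx F set0)).
Proof.
move=> u1; apply/ffunP => K; rewrite sum_ffunE.
have [/eqP/cards1P[i ->]|K1] := eqVneq #|K| 1; last first.
  rewrite u1 // big1 // => i _; rewrite -dx1E !ffunE.
  by have [E|_] := eqVneq; [rewrite E cards1 in K1|rewrite mulr0].
rewrite (bigD1 i) //= -dx1E !ffunE eqxx mulr1 big1 ?addr0 // => j ji.
by rewrite -dx1E !ffunE (inj_eq set1_inj) eq_sym (negPf ji) mulr0.
Qed.

Lemma wedge_CA s t u : Omega 1 u -> wedge s (wedge u t) = wedge u (wedge (sgf s) t).
Proof.
move=> /form1_sum ->; rewrite !wedge_suml raddf_sum; apply: eq_bigr => i _ /=.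
by rewrite !wedge_fscale wedge_fscaler !wedge_extl wedge1 wedge_extlr wedge1.
Qed.

Lemma pd_wedge i s t : pd i (wedge s t) = wedge (pd i s) t + wedge s (pd i t).
Proof.
elim/form_ind: s => [f|s s' Hs Hs'|j s Hs].
- have -> : pd i (fscale f (dx F set0)) = fscale (mderiv i f) (dx F set0).
    rewrite pd_fscale [X in fscale f X](_ : _ = 0) ?raddf0 ?addr0 //.
    by apply/ffunP => K; rewrite !ffunE; case: eqP; rewrite /= ?mderiv0 // -mpolyC1 mderivC.
  by rewrite !wedge_fscale !wedge1 pd_fscale.
- by rewrite !(raddfD, wedgeDl) /= Hs Hs' addrACA.
- by rewrite !(wedge_extl, pd_extl) Hs raddfD.
Qed.

(** In the induction, the sign that [intlE] produces when crossing [extl j] is matched by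
    [sgf_extl]. *)
Lemma intl_wedge i s t :
  intl i (wedge s t) = wedge (intl i s) t + wedge (sgf s) (intl i t).
Proof.
elim/form_ind: s => [f|s s' Hs Hs'|j s Hs].
- have -> : intl i (fscale f (dx F set0)) = 0.
    apply/ffunP => K; rewrite !ffunE; case: ifP => // _.
    by rewrite setU_eq0 -cards_eq0 cards1 /= !mulr0.
  by rewrite sgf_fscale sgf_dx0 wedge0l !wedge_fscale !wedge1 add0r intl_fscale.
- by rewrite !(raddfD, wedgeDl) /= Hs Hs' addrACA.
- rewrite !(wedge_extl, intlE) Hs raddfD /= wedgeDl wedgeZl wedgeNl wedge_extl.
  by rewrite sgf_extl wedgeNl wedge_extl opprD addrA.
Qed.

Lemma sgfK : involutive sgf.
Proof.
move=> s; apply/ffunP => K; rewrite !ffunE mulrA -exprD addnn -signr_odd odd_double.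
by rewrite mul1r.
Qed.

Lemma extd_is_linear : linear (@extd F n).
Proof.
move=> c s t; rewrite !extdE scaler_sumr -big_split /=.
by apply: eq_bigr => i _; rewrite !linearP.
Qed.
HB.instance Definition _ :=
  GRing.isLinear.Build F (diffForm F n) (diffForm F n) _ (@extd F n) extd_is_linear.

Lemma contract_is_linear X : linear (@contract F n X).
Proof.
move=> c s t; rewrite !contractE scaler_sumr -big_split /=.
by apply: eq_bigr => i _; rewrite !linearP.
Qed.
HB.instance Definition _ X :=
  GRing.isLinear.Build F (diffForm F n) (diffForm F n) _ (@contract F n X)
    (@contract_is_linear X).

Lemma contractDl X Y t : contract (X + Y) t = contract X t + contract Y t.
Proof.
by rewrite !contractE -big_split; apply: eq_bigr => i _; rewrite ffunE fscaleDl.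
Qed.

Lemma contract_vscale f X t : contract (vscale f X) t = fscale f (contract X t).
Proof.
rewrite !contractE raddf_sum; apply: eq_bigr => i _ /=.
by rewrite ffunE fscaleA.
Qed.

Lemma contract_fscale f X t : contract X (fscale f t) = fscale f (contract X t).
Proof.
rewrite !contractE raddf_sum; apply: eq_bigr => i _ /=.
by rewrite intl_fscale fscaleC.
Qed.

Lemma extd_wedge s t : extd (wedge s t) = wedge (extd s) t + wedge (sgf s) (extd t).
Proof.
rewrite !extdE wedge_suml raddf_sum -big_split /=.
by apply: eq_bigr => i _; rewrite pd_wedge raddfD /= wedge_extl wedge_extlr sgfK.
Qed.

Lemma contract_wedge X s t :
  contract X (wedge s t) = wedge (contract X s) t + wedge (sgf s) (contract X t).
Proof.
rewrite !contractE wedge_suml raddf_sum -big_split /=.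
by apply: eq_bigr => i _; rewrite intl_wedge raddfD /= wedge_fscale wedge_fscaler.
Qed.

(** Since 2 is invertible in [F], antisymmetry of an expression forces it to vanish. *)
Lemma opp_eq0 (s : diffForm F n) : s = - s -> s = 0.
Proof.
move/eqP; rewrite -addr_eq0 -mulr2n -scaler_nat scaler_eq0 pnatr_eq0 /=.
by move/eqP.
Qed.

(** In the double sum the [pd] commute and the [extl] anticommute, so exchanging the indices yields
    the opposite sum. *)
Lemma extdK t : extd (extd t) = 0.
Proof.
apply: opp_eq0; have E : extd (extd t) = \sum_i \sum_j extl i (extl j (pd i (pd j t))).
  rewrite [LHS]extdE; apply: eq_bigr => i _; rewrite extdE !raddf_sum /=.
  by apply: eq_bigr => j _; rewrite pd_extl.
rewrite {1}E exchange_big E -sumrN; apply: eq_bigr => i _.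
by rewrite -sumrN; apply: eq_bigr => j _ /=; rewrite extlC pdC.
Qed.

Lemma contractC X Y t : contract X (contract Y t) = - contract Y (contract X t).
Proof.
rewrite !contractE; under eq_bigr do rewrite !raddf_sum /=.
rewrite exchange_big -sumrN; apply: eq_bigr => j _.
rewrite !raddf_sum /=; apply: eq_bigr => i _.
by rewrite !intl_fscale fscaleC intlC !raddfN.
Qed.

(** * The form degree [r] *)

Lemma Omega0 r : Omega r (0 : diffForm F n).
Proof. by move=> I _; rewrite ffunE. Qed.

Lemma OmegaD r s t : Omega r s -> Omega r t -> Omega r (s + t).
Proof. by move=> sr tr I Ir; rewrite ffunE sr ?tr ?addr0. Qed.

Lemma OmegaZ r c t : Omega r t -> Omega r (c *: t).
Proof. by move=> tr I Ir; rewrite ffunE tr ?scaler0. Qed.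

Lemma OmegaN r t : Omega r t -> Omega r (- t).
Proof. by move=> tr I Ir; rewrite ffunE tr ?oppr0. Qed.

Lemma Omega_sum r (T : Type) (l : seq T) (P : pred T) (G : T -> diffForm F n) :
  (forall k, P k -> Omega r (G k)) -> Omega r (\sum_(k <- l | P k) G k).
Proof. by move=> Gr; elim/big_ind: _ => //; [exact: Omega0|exact: OmegaD]. Qed.

Lemma Omega_fscale r f t : Omega r t -> Omega r (fscale f t).
Proof. by move=> tr I Ir; rewrite ffunE tr ?mulr0. Qed.

Lemma Omega_extl r i t : Omega r t -> Omega r.+1 (extl i t).
Proof.
move=> tr I Ir; rewrite ffunE; case: ifP => // iI; rewrite tr ?mulr0 //.
by move: Ir; rewrite (cardsD1 i) iI eqSS.
Qed.

(** The truncated predecessor is harmless at [r = 0], where the contraction vanishes. *)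
Lemma Omega_intl r i t : Omega r t -> Omega r.-1 (intl i t).
Proof.
move=> tr I Ir; rewrite ffunE; case: ifP => // /negbT iI; rewrite tr ?mulr0 //.
by move: Ir; rewrite cardsU1 iI; apply: contraNneq => <-.
Qed.

Lemma intl_Omega0 i t : Omega 0 t -> intl i t = 0.
Proof.
move=> t0; apply/ffunP => I; rewrite !ffunE; case: ifP => // /negbT iI.
by rewrite t0 ?mulr0 // cardsU1 iI.
Qed.

Lemma Omega_pd r i t : Omega r t -> Omega r (pd i t).
Proof. by move=> tr I Ir; rewrite ffunE tr ?mderiv0. Qed.

Lemma Omega_extd r t : Omega r t -> Omega r.+1 (extd t).
Proof.
by move=> tr; rewrite extdE; apply: Omega_sum => i _; apply/Omega_extl/Omega_pd.
Qed.

Lemma Omega_contract r X t : Omega r t -> Omega r.-1 (contract X t).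
Proof.
by move=> tr; rewrite contractE; apply: Omega_sum => i _; apply/Omega_fscale/Omega_intl.
Qed.

Lemma contract_Omega0 X t : Omega 0 t -> contract X t = 0.
Proof.
by move=> t0; rewrite contractE big1 // => i _; rewrite intl_Omega0 // raddf0.
Qed.

Lemma Omega_wedge k r s t : Omega k s -> Omega r t -> Omega (k + r) (wedge s t).
Proof.
move=> sk tr K Kkr; rewrite ffunE big1 // => I IK.
have [Ik|/sk ->] := eqVneq #|I| k; last by rewrite mul0r mulr0.
rewrite tr ?mulr0 //; apply: contraNneq Kkr => <-.
by rewrite -Ik cardsD (setIidPr IK) subnKC ?subset_leq_card.
Qed.

Lemma Omega_dfun f : Omega 1 (dfun f).
Proof.
rewrite /dfun; apply: Omega_sum => i _; apply: Omega_fscale; rewrite dx1E.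
exact/Omega_extl/Omega_dx0.
Qed.

Lemma wedge1r t : wedge t (dx F set0) = t.
Proof.
elim/form_ind: t => [f|s s' Hs Hs'|j s Hs].
- by rewrite wedge_fscale wedge1.
- by rewrite wedgeDl Hs Hs'.
- by rewrite wedge_extl Hs.
Qed.

Lemma wedgeC1 s u : Omega 1 u -> wedge s u = wedge u (sgf s).
Proof.
move=> u1; have := @wedge_CA s (dx F set0) u u1.
by rewrite !wedge1r.
Qed.

(** Viewing df as the exterior differential of a 0-form makes the Leibniz rule and [extdK] available
    for it. *)
Lemma dfunE f : dfun f = extd (fscale f (dx F set0)).
Proof.
rewrite extdE; apply: eq_bigr => i _; rewrite dx1E -extl_fscale; congr extl.
apply/ffunP => K; rewrite !ffunE; case: eqP => _; rewrite ?mulr1 ?mulr0 ?mderiv0 //.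
Qed.

Lemma dfun_is_linear : linear (@dfun F n).
Proof.
move=> c f g; rewrite !dfunE -linearP /=; congr extd.
by rewrite fscaleDl fscaleZl.
Qed.
HB.instance Definition _ :=
  GRing.isLinear.Build F {mpoly F[n]} (diffForm F n) _ (@dfun F n) dfun_is_linear.

Lemma fscaleDr f s t : fscale f (s + t) = fscale f s + fscale f t.
Proof. exact: raddfD. Qed.

Lemma wedgeDr s t u : wedge s (t + u) = wedge s t + wedge s u.
Proof. exact: raddfD. Qed.

Lemma contractDr X s t : contract X (s + t) = contract X s + contract X t.
Proof. exact: raddfD. Qed.

Lemma extdD s t : extd (s + t) = extd s + extd t.
Proof. exact: raddfD. Qed.

Lemma fscaleZr k f t : fscale f (k *: t) = k *: fscale f t.
Proof. exact: linearZ. Qed.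

Lemma wedgeZr k s t : wedge s (k *: t) = k *: wedge s t.
Proof. exact: linearZ. Qed.

Lemma contractZr k X t : contract X (k *: t) = k *: contract X t.
Proof. exact: linearZ. Qed.

Lemma extdZ k t : extd (k *: t) = k *: extd t.
Proof. exact: linearZ. Qed.

Lemma wedgeNr s t : wedge s (- t) = - wedge s t.
Proof. exact: raddfN. Qed.

Lemma dfunD f g : dfun (f + g) = dfun f + dfun g.
Proof. exact: raddfD. Qed.

Lemma dfunZ k f : dfun (k *: f) = k *: dfun f.
Proof. exact: linearZ. Qed.

Lemma extd_fscale f t : extd (fscale f t) = wedge (dfun f) t + fscale f (extd t).
Proof.
have -> : fscale f t = wedge (fscale f (dx F set0)) t by rewrite wedge_fscale wedge1.
by rewrite extd_wedge -dfunE sgf_fscale sgf_dx0 wedge_fscale wedge1.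
Qed.

Lemma extd_wedge_dfun f t : extd (wedge (dfun f) t) = - wedge (dfun f) (extd t).
Proof.
rewrite extd_wedge dfunE extdK wedge0l add0r -dfunE.
by rewrite (sgf_Omega (Omega_dfun f)) expr1 scaleN1r wedgeNl.
Qed.

Lemma contract_dfun X f :
  contract X (dfun f) = fscale (\sum_i X i * mderiv i f) (dx F set0).
Proof.
rewrite contractE fscale_suml; apply: eq_bigr => i _.
rewrite -fscaleA; congr fscale; rewrite /dfun raddf_sum (bigD1 i) //=.
rewrite dx1E intl_fscale intlE eqxx scale1r intl_Omega0 ?raddf0 ?subr0; last exact: Omega_dx0.
rewrite big1 ?addr0 // => j ji.
rewrite dx1E intl_fscale intlE eq_sym (negPf ji) scale0r sub0r.
rewrite intl_Omega0 ?raddf0 ?oppr0 ?raddf0 //.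
exact: Omega_dx0.
Qed.

Lemma contract_wedge_dfun X f t :
  contract X (wedge (dfun f) t) =
  fscale (\sum_i X i * mderiv i f) t - wedge (dfun f) (contract X t).
Proof.
rewrite contract_wedge contract_dfun wedge_fscale wedge1.
by rewrite (sgf_Omega (Omega_dfun f)) expr1 scaleN1r wedgeNl.
Qed.

End Calculus.

(** * Degrees *)

Section Homogeneity.
Variables (F : numFieldType) (n : nat).
Implicit Types (f g p q : {mpoly F[n]}) (s t u : diffForm F n) (X Y : vectField F n).
Implicit Types (i j : 'I_n) (I J K : {set 'I_n}) (b c d e : int).

(* Degrees are integers so that contraction may lower them; 0 is the only
   element of a negative degree. *)
Definition phom d p := forall m, p@_m != 0 -> (mdeg m)%:Z = d.

Definition fhom b t := forall I, phom (b - #|I|%:Z) (t I).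

Definition vhom b X := forall i, phom (b + 1) (X i).

Lemma phom0 d : phom d 0.
Proof. by move=> m; rewrite mcoeff0 eqxx. Qed.

Lemma phomD d p q : phom d p -> phom d q -> phom d (p + q).
Proof.
move=> pd qd m; rewrite mcoeffD => nz.
have [p0|/pd //] := eqVneq p@_m 0.
by apply: qd; move: nz; rewrite p0 add0r.
Qed.

Lemma phomZ d (a : F) p : phom d p -> phom d (a *: p).
Proof. by move=> pd m; rewrite mcoeffZ mulf_eq0 negb_or => /andP[_ /pd]. Qed.

Lemma phom_sum d (T : Type) (l : seq T) (P : pred T) (G : T -> {mpoly F[n]}) :
  (forall k, P k -> phom d (G k)) -> phom d (\sum_(k <- l | P k) G k).
Proof. by move=> Gd; elim/big_ind: _ => //; [exact: phom0|exact: phomD]. Qed.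

Lemma phomM d e p q : phom d p -> phom e q -> phom (d + e) (p * q).
Proof.
move=> pd qe m; rewrite -mcoeff_msupp => /msuppM_le /allpairsP[[m1 m2] /= [m1p m2q ->]].
by rewrite mdegD PoszD (pd m1) ?(qe m2) -?mcoeff_msupp.
Qed.

Lemma phom_sign d k p : phom d p -> phom d ((-1) ^+ k * p).
Proof.
rewrite -signr_odd; case: odd; rewrite ?expr0 ?mul1r // expr1 mulN1r -scaleN1r.
exact: phomZ.
Qed.

Lemma phomX i : phom 1 ('X_i : {mpoly F[n]}).
Proof.
by move=> m; rewrite mcoeffX; case: (U_(i)%MM =P m) => [<- _|_]; rewrite ?mdeg1 ?eqxx.
Qed.

Lemma phom_deriv d i p : phom d p -> phom (d - 1) (mderiv i p).
Proof.
move=> pd m; rewrite mcoeff_mderiv -mulr_natr mulf_eq0 negb_or => /andP[/pd <- _].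
by rewrite mdegD mdeg1 PoszD addrK.
Qed.

Lemma phom_homog (k : nat) p : reflect (phom k p) (p \is k.-homog).
Proof.
apply: (iffP (dhomogP _ _ _)) => [pk m|pk m mp].
  by rewrite -mcoeff_msupp => /pk ->.
by apply/eqP; rewrite -eqz_nat; apply/eqP/pk; rewrite -mcoeff_msupp.
Qed.

(** On a monomial ['X_[m]], deriving in [x_i] and multiplying back by [x_i] gives the factor [m i];
    the exponents add up to [mdeg m]. *)
Lemma euler d p : phom d p -> \sum_i 'X_i * mderiv i p = d%:~R *: p.
Proof.
move=> pd; rewrite [in RHS](mpolyE p) scaler_sumr.
under eq_bigr => i _ do rewrite [X in mderiv i X]mpolyE raddf_sum big_distrr /=.
rewrite exchange_big /= big_seq [RHS]big_seq; apply: eq_bigr => m mp.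
rewrite -(pd m) -?mcoeff_msupp // mdegE -[(_)%:~R]/(_%:R) natr_sum scaler_suml.
apply: eq_bigr => i _; rewrite mderivZ mderivX.
(* A zero exponent is set apart because [m - U_(i)] truncates there. *)
have [->|mi] := eqVneq (m i) 0%N; first by rewrite !scale0r scaler0 mulr0.
rewrite scalerA mulrC -scalerAl scalerA; congr (_ *: _); first exact: mulrC.
rewrite -mpolyXD submK //; apply/mnm_lepP => j; rewrite mnm1E.
by case: eqP => // <-; rewrite lt0n.
Qed.

Lemma fhom0 b : fhom b (0 : diffForm F n).
Proof. by move=> I; rewrite ffunE; apply: phom0. Qed.

Lemma fhomD b s t : fhom b s -> fhom b t -> fhom b (s + t).
Proof. by move=> sb tb I; rewrite ffunE; apply: phomD. Qed.

Lemma fhomZ b (a : F) t : fhom b t -> fhom b (a *: t).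
Proof. by move=> tb I; rewrite ffunE; apply: phomZ. Qed.

Lemma fhomN b t : fhom b t -> fhom b (- t).
Proof. by rewrite -scaleN1r; apply: fhomZ. Qed.

Lemma fhom_sum b (T : Type) (l : seq T) (P : pred T) (G : T -> diffForm F n) :
  (forall k, P k -> fhom b (G k)) -> fhom b (\sum_(k <- l | P k) G k).
Proof. by move=> Gb; elim/big_ind: _ => //; [exact: fhom0|exact: fhomD]. Qed.

Lemma fhom_fscale c b f t : phom c f -> fhom b t -> fhom (c + b) (fscale f t).
Proof. by move=> fc tb I; rewrite ffunE -addrA; apply: phomM. Qed.

Lemma fhom_extl b i t : fhom b t -> fhom (b + 1) (extl i t).
Proof.
move=> tb I; rewrite ffunE; case: ifP => iI; last exact: phom0.
apply: phom_sign; rewrite (cardsD1 i) iI.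
by have -> : b + 1 - (true + #|I :\ i|)%N%:Z = b - #|I :\ i|%:Z by rewrite PoszD /=; ring.
Qed.

Lemma fhom_intl b i t : fhom b t -> fhom (b - 1) (intl i t).
Proof.
move=> tb I; rewrite ffunE; case: ifP => iI; first exact: phom0.
apply: phom_sign; have := tb (i |: I); rewrite cardsU1 iI.
by have -> : b - (true + #|I|)%N%:Z = b - 1 - #|I|%:Z by rewrite PoszD /=; ring.
Qed.

Lemma fhom_pd b i t : fhom b t -> fhom (b - 1) (pd i t).
Proof. by move=> tb I; rewrite ffunE addrAC; apply: phom_deriv. Qed.

Lemma fhom_extd b t : fhom b t -> fhom b (extd t).
Proof.
move=> tb; rewrite extdE; apply: fhom_sum => i _.
by rewrite -(subrK 1 b); apply/fhom_extl/fhom_pd.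
Qed.

Lemma fhom_contract c b X t : vhom c X -> fhom b t -> fhom (c + b) (contract X t).
Proof.
move=> Xc tb; rewrite contractE; apply: fhom_sum => i _.
have -> : c + b = (c + 1) + (b - 1) by ring.
by apply: fhom_fscale (Xc i) _; apply: fhom_intl.
Qed.

Lemma fhom_wedge c b s t : fhom c s -> fhom b t -> fhom (c + b) (wedge s t).
Proof.
move=> sc tb K; rewrite ffunE; apply: phom_sum => I IK; apply: phom_sign.
have -> : c + b - #|K|%:Z = (c - #|I|%:Z) + (b - #|K :\: I|%:Z); last exact: phomM.
by rewrite -(cardsID I K) (setIidPr IK) PoszD; ring.
Qed.

Lemma fhom_dfun c f : phom c f -> fhom c (dfun f).
Proof.
move=> fc; rewrite /dfun; apply: fhom_sum => i _.
rewrite -[c](subrK 1); apply: fhom_fscale; first exact: phom_deriv.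
move=> I; rewrite ffunE; case: eqP => [->|_]; last exact: phom0.
by rewrite cards1 subrr; apply/(@phom_homog 0%N); rewrite dhomog1.
Qed.

Lemma vhom_radial : vhom 0 (radial F n).
Proof. by move=> i; rewrite ffunE; apply: phomX. Qed.

Lemma fhom_radial b t : fhom b t -> fhom b (contract (radial F n) t).
Proof. by move=> tb; rewrite -[b]add0r; apply: fhom_contract => //; apply: vhom_radial. Qed.

(** This is the number operator: the term of index [i] fixes [dx_I] when [i] is in [I] and kills it
    otherwise. *)
Lemma extl_intl_sum t I : (\sum_i extl i (intl i t)) I = #|I|%:R *: t I.
Proof.
rewrite sum_ffunE (eq_bigr (fun i => if i \in I then t I else 0)).
  by rewrite -big_mkcond sumr_const scaler_nat.
move=> i _; rewrite !ffunE !inE eqxx; case: ifP => // iI.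
rewrite (@belowD1 _ i i I) // ltnn add0n mulrA -exprD addnn -signr_odd odd_double.
by rewrite mul1r setD1K.
Qed.

(* Cartan's formula for the Lie derivative along the radial field, which acts
   on forms of degree b as multiplication by b. *)
Lemma cartan_radial b t : fhom b t ->
  contract (radial F n) (extd t) + extd (contract (radial F n) t) = b%:~R *: t.
Proof.
move=> tb.
(* The Lie derivative splits into the Euler field on coefficients, which contributes [b - #|I|], and
   the number operator, which contributes [#|I|]. *)
have -> : contract (radial F n) (extd t) + extd (contract (radial F n) t) =
    \sum_i fscale 'X_i (pd i t) + \sum_i extl i (intl i t).
  (* By the anticommutation relation only diagonal terms remain; the second summand comes from
     differentiating ['X_i]. *)
  have Xij i j : fscale 'X_i (intl i (extl j (pd j t))) + extl j (pd j (fscale 'X_i (intl i t))) =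
      (i == j)%:R *: (fscale 'X_i (pd j t) + extl j (intl i t)).
    rewrite pd_fscale raddfD /= !extl_fscale pd_intl intlE raddfB /= addrCA subrK.
    rewrite scalerDr linearZ /= addrC; congr (_ + _).
    rewrite mderivX mnm1E; have [->|_] := eqVneq i j; last by rewrite !scale0r fscale0l.
    have -> : (U_(j) - U_(j))%MM = 0%MM :> 'X_{1..n} by apply/mnmP => k; rewrite !mnmE subnn.
    by rewrite mpolyX0 !scale1r fscale1.
  transitivity (\sum_i \sum_j ((i == j)%:R *: (fscale 'X_i (pd j t) + extl j (intl i t)))).
    rewrite !contractE !extdE.
    have -> : \sum_j extl j (pd j (\sum_i fscale (radial F n i) (intl i t))) =
        \sum_i \sum_j extl j (pd j (fscale (radial F n i) (intl i t))).
      rewrite exchange_big; apply: eq_bigr => j _.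
      by rewrite !raddf_sum.
    rewrite -big_split; apply: eq_bigr => i _ /=.
    rewrite !raddf_sum -big_split; apply: eq_bigr => j _ /=.
    by rewrite -Xij ffunE.
  rewrite -big_split; apply: eq_bigr => i _ /=.
  rewrite (bigD1 i) //= eqxx scale1r big1 ?addr0 // => j ji.
  by rewrite eq_sym (negPf ji) scale0r.
apply/ffunP => I; rewrite ffunE extl_intl_sum sum_ffunE.
under eq_bigr do rewrite !ffunE.
rewrite (euler (tb I)) -scalerDl ffunE; congr (_ *: _).
by rewrite rmorphB /= subrK.
Qed.

End Homogeneity.

(** * Graded modules with a twisted action *)

Lemma sum_ord_widen (V : nmodType) (G : nat -> V) (P : pred nat) (m k : nat) :
  (m <= k)%N -> (forall b, (m <= b)%N -> G b = 0) ->
  \sum_(b < m | P b) G b = \sum_(b < k | P b) G b.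
Proof.
move=> mk G0; rewrite (big_ord_widen_cond k P G mk) big_mkcondr /=.
by apply: eq_bigr => b _; case: ltnP => // /G0 ->.
Qed.

(* M is the direct sum of its homogeneous parts H b over the degrees b in Q;
   acth c b is the action of degree c polynomials on H b. *)
Record graded_action (F : numFieldType) (n : nat) (V : lmodType F)
    (M : V -> Prop) (act : {mpoly F[n]} -> V -> V) (Q : pred nat)
    (H : nat -> V -> Prop) (comp : nat -> V -> V) (size : V -> nat)
    (acth : nat -> nat -> {mpoly F[n]} -> V -> V) : Prop := GradedAction {
  gr_actE : forall f x, act f x =
    \sum_(c < msize f) \sum_(b < size x | Q b) acth c b (pihomog mdeg c f) (comp b x);
  gr_M0 : M 0;
  gr_MB : forall x y, M x -> M y -> M (x - y);
  gr_compB : forall b, {morph comp b : x y / x - y};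
  gr_comp_ge : forall b x, (size x <= b)%N -> comp b x = 0;
  gr_comp_sum : forall x, M x -> x = \sum_(b < size x | Q b) comp b x;
  gr_comp_in : forall b x, M x -> Q b -> H b (comp b x);
  gr_compE : forall b b' x, H b x -> comp b' x = if b' == b then x else 0;
  gr_HM : forall b x, Q b -> H b x -> M x;
  gr_acthDl : forall c b x, {morph (acth c b)^~ x : f g / f + g};
  gr_acthDr : forall c b f, {morph acth c b f : x y / x + y};
  gr_QD : forall c b, Q b -> Q (c + b)%N;
  gr_acth_in : forall c b f x, f \is c.-homog -> Q b -> H b x -> H (c + b)%N (acth c b f x);
  gr_acthA : forall c e b f g x, f \is c.-homog -> g \is e.-homog -> Q b -> H b x ->
    acth c (e + b)%N f (acth e b g x) = acth (c + e)%N b (f * g) x;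
  gr_acth_const : forall b (k : F) x, Q b -> H b x -> acth 0 b k%:MP x = k *: x
}.

Lemma mpoly_homog_ind (F : numFieldType) (n : nat) (P : {mpoly F[n]} -> Prop) :
  (forall f g, P f -> P g -> P (f + g)) ->
  (forall (c : nat) f, f \is c.-homog -> P f) -> forall f, P f.
Proof.
move=> PD Ph f; rewrite (pihomog_partitionE (leqnn (msize f))).
elim/big_ind: _ => [||c _]; [exact/(Ph 0%N)/rpred0|exact: PD|].
by apply: (Ph c); apply: pihomogP.
Qed.

Section GradedAction.
Variables (F : numFieldType) (n : nat) (V : lmodType F) (M : V -> Prop)
  (act : {mpoly F[n]} -> V -> V) (Q : pred nat) (H : nat -> V -> Prop)
  (comp : nat -> V -> V) (size : V -> nat)
  (acth : nat -> nat -> {mpoly F[n]} -> V -> V).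
Hypothesis gr : graded_action M act Q H comp size acth.
Implicit Types (f g : {mpoly F[n]}) (x y : V).

Lemma gr_acth0l c b x : acth c b 0 x = 0.
Proof. by apply: (addrI (acth c b 0 x)); rewrite -(gr_acthDl gr) !addr0. Qed.

Lemma gr_acth0r c b f : acth c b f 0 = 0.
Proof. by apply: (addrI (acth c b f 0)); rewrite -(gr_acthDr gr) !addr0. Qed.

Lemma gr_compD b : {morph comp b : x y / x + y}.
Proof.
have c0 : comp b 0 = 0 by rewrite -[X in comp b X](subrr 0) (gr_compB gr) subrr.
have cN y : comp b (- y) = - comp b y by rewrite -[- y]add0r (gr_compB gr) c0 add0r.
by move=> x y; rewrite -{1}[y]opprK (gr_compB gr) cN opprK.
Qed.

Lemma gr_MD x y : M x -> M y -> M (x + y).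
Proof.
move=> Mx My; rewrite -[y]opprK; apply: (gr_MB gr) => //; rewrite -sub0r.
by apply: (gr_MB gr) => //; apply: (gr_M0 gr).
Qed.

(** The bounds [msize f] and [size x] vary with the arguments. Enlarging them adds only zero terms,
    so elements of different sizes can be compared over common ranges. *)
Lemma gr_act_widen (C B : nat) f x : (msize f <= C)%N -> (size x <= B)%N ->
  act f x = \sum_(c < C) \sum_(b < B | Q b) acth c b (pihomog mdeg c f) (comp b x).
Proof.
move=> fC xB; rewrite (gr_actE gr).
under eq_bigr => c _.
  rewrite (@sum_ord_widen _ (fun b => acth c b (pihomog mdeg c f) (comp b x)) Q _ _ xB).
    over.
  by move=> b /(gr_comp_ge gr) ->; rewrite gr_acth0r.
apply: (@sum_ord_widen _ (fun c => \sum_(b < B | Q b) acth c b (pihomog mdeg c f) (comp b x))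
  predT _ _ fC) => c fc.
rewrite big1 // => b _; suff -> : pihomog mdeg c f = 0 by exact: gr_acth0l.
rewrite pihomogE big_seq_cond big1 // => m /andP[/msize_mdeg_lt mf /eqP mc].
by move: (leq_trans mf fc); rewrite mc ltnn.
Qed.

Lemma gr_actDl x : {morph act^~ x : f g / f + g}.
Proof.
move=> f g /=; pose C := maxn (msize (f + g)) (maxn (msize f) (msize g)).
rewrite !(@gr_act_widen C (size x)) ?leq_max ?leqnn ?orbT // -big_split.
apply: eq_bigr => c _; rewrite -big_split; apply: eq_bigr => b _ /=.
by rewrite raddfD (gr_acthDl gr).
Qed.

Lemma gr_actDr f : {morph act f : x y / x + y}.
Proof.
move=> x y; pose B := maxn (size (x + y)) (maxn (size x) (size y)).
rewrite !(@gr_act_widen (msize f) B) ?leq_max ?leqnn ?orbT // -big_split.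
apply: eq_bigr => c _; rewrite -big_split; apply: eq_bigr => b _ /=.
by rewrite gr_compD (gr_acthDr gr).
Qed.

Lemma gr_act0r f : act f 0 = 0.
Proof. by apply: (addrI (act f 0)); rewrite -gr_actDr !addr0. Qed.

Lemma gr_act_homog c b f x : f \is c.-homog -> Q b -> H b x -> act f x = acth c b f x.
Proof.
move=> fc Qb xb.
(* The ranges are enlarged to contain [c] and [b] even when [f] or [x] is zero. *)
rewrite (@gr_act_widen (maxn (msize f) c.+1) (maxn (size x) b.+1)) ?leq_maxl //.
have cC : (c < maxn (msize f) c.+1)%N by rewrite leq_max leqnn orbT.
have bB : (b < maxn (size x) b.+1)%N by rewrite leq_max leqnn orbT.
rewrite (bigD1 (Ordinal cC)) //= [X in _ + X]big1 ?addr0 => [|c' c'c]; last first.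
  rewrite big1 // => b' _; rewrite (pihomog_ne0 _ fc) ?gr_acth0l //.
  by rewrite eq_sym.
rewrite (bigD1 (Ordinal bB)) //= big1 ?addr0 => [|b' /andP[_ b'b]]; last first.
  by rewrite (gr_compE gr _ xb) (negPf (b'b : (b' != b :> nat)%N)) gr_acth0r.
by rewrite (gr_compE gr _ xb) eqxx pihomog_dE.
Qed.

Lemma gr_ind (P : V -> Prop) : P 0 -> (forall x y, P x -> P y -> P (x + y)) ->
  (forall b x, Q b -> H b x -> P x) -> forall x, M x -> P x.
Proof.
move=> P0 PD PH x Mx; rewrite (gr_comp_sum gr Mx); elim/big_ind: _ => // b Qb.
by apply: (PH b) => //; apply: (gr_comp_in gr).
Qed.

Lemma gr_act_in f x : M x -> M (act f x).
Proof.
move=> Mx; elim/mpoly_homog_ind: f => [f g Mf Mg|c f fc].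
  by rewrite gr_actDl; apply: gr_MD.
elim/gr_ind: x / Mx => [|x y Mx My|b x Qb xb]; first by rewrite gr_act0r; exact: (gr_M0 gr).
  by rewrite gr_actDr; apply: gr_MD.
rewrite (gr_act_homog fc Qb xb); apply: (gr_HM gr (b := (c + b)%N)).
  exact: (gr_QD gr).
exact: (gr_acth_in gr).
Qed.

(** Additivity in all three arguments reduces associativity to homogeneous elements, where it is
    [gr_acthA]. *)
Lemma gr_actA f g x : M x -> act f (act g x) = act (f * g) x.
Proof.
move=> Mx; elim/mpoly_homog_ind: f => [f f' Hf Hf'|c f fc].
  by rewrite mulrDl !gr_actDl Hf Hf'.
elim/mpoly_homog_ind: g => [g g' Hg Hg'|e g ge].
  by rewrite mulrDr !gr_actDl gr_actDr Hg Hg'.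
elim/gr_ind: x / Mx => [|x y Hx Hy|b x Qb xb]; first by rewrite !gr_act0r.
  by rewrite !gr_actDr Hx Hy.
rewrite (gr_act_homog ge Qb xb) (gr_act_homog (dhomogM fc ge) Qb xb).
rewrite (gr_act_homog fc (gr_QD gr e Qb) (gr_acth_in gr ge Qb xb)).
exact: (gr_acthA gr).
Qed.

(** This yields the unit axiom and turns [F]-linear combinations of generators into combinations
    over the polynomial ring. *)
Lemma gr_act_const (k : F) x : M x -> act k%:MP x = k *: x.
Proof.
elim/gr_ind => {x} [|x y Hx Hy|b x Qb xb]; first by rewrite gr_act0r scaler0.
  by rewrite gr_actDr Hx Hy scalerDr.
rewrite (@gr_act_homog 0 b _ _ _ Qb xb); first exact: (gr_acth_const gr).
by rewrite -[k%:MP]mulr1 mul_mpolyC dhomogZ ?dhomog1.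
Qed.

Lemma graded_module : is_module M act.
Proof.
split; [exact: (gr_M0 gr)|exact: (gr_MB gr)|exact: gr_act_in|exact: gr_actA| | |].
- by move=> x Mx; rewrite -mpolyC1 gr_act_const // scale1r.
- by move=> f x y _ _; apply: gr_actDr.
- by move=> f g x _; apply: gr_actDl.
Qed.

(** The span of [gen] contains the degrees up to [B] by assumption. Above [B] a homogeneous element
    is a sum of variables acting on elements one degree lower, so induction on the degree reaches
    it. *)
Lemma graded_fin_gen (K : finType) (gen : K -> V) (B : nat) :
  (forall k, M (gen k)) ->
  (forall b x, (b <= B)%N -> Q b -> H b x -> exists c : K -> F, x = \sum_k c k *: gen k) ->
  (forall b, (B <= b)%N -> Q b) ->
  (forall b x, (B <= b)%N -> H b.+1 x ->
     exists y : 'I_n -> V, (forall i, H b (y i)) /\ x = \sum_i acth 1 b 'X_i (y i)) ->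
  fin_gen M act.
Proof.
move=> Mg low QB high.
pose Sp x := exists f : K -> {mpoly F[n]}, x = \sum_k act (f k) (gen k).
have SpD x y : Sp x -> Sp y -> Sp (x + y).
  move=> [f ->] [g ->]; exists (fun k => f k + g k); rewrite -big_split.
  by apply: eq_bigr => k _; rewrite /= gr_actDl.
have Sp_low b x : (b <= B)%N -> Q b -> H b x -> Sp x.
  move=> bB Qb /(low b x bB Qb) [c ->]; exists (fun k => (c k)%:MP).
  by apply: eq_bigr => k _; rewrite gr_act_const.
have Sp0 : Sp 0.
  exists (fun => 0); rewrite big1 // => k _; apply: (addrI (act 0 (gen k))).
  by rewrite -gr_actDl !addr0.
have SpA f x : Sp x -> Sp (act f x).
  move=> [g ->]; exists (fun k => f * g k); elim/big_rec2: _ => [|k y z _ Ez].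
    exact: gr_act0r.
  by rewrite gr_actDr Ez gr_actA.
have SpH b x : Q b -> H b x -> Sp x.
  elim: b x => [|b IH] x Qb xb; first exact: (Sp_low 0%N).
  have [bB|Bb] := leqP b.+1 B; first exact: (Sp_low b.+1).
  have [y [yb ->]] := high b x Bb xb.
  elim/big_ind: _ => // i _; rewrite -(gr_act_homog (c := 1)) //; last exact: QB.
    by apply/SpA/IH => //; apply: QB.
  by rewrite dhomogX /= mdeg1.
exists #|K|, (gen \o enum_val); split=> [k|x Mx]; first exact: Mg.
have [f ->] : Sp x by elim/gr_ind: x / Mx.
exists (f \o enum_val); rewrite (reindex _ (onW_bij _ (enum_val_bij K))).
by apply: eq_bigl => k.
Qed.

End GradedAction.

(** Both actions and [phi] are additive, so linearity is tested on homogeneous elements only; [d] is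
    the degree shift of [phi]. *)
Lemma graded_module_hom (F : numFieldType) (n : nat) (V W : lmodType F)
    M act Q H comp size acth M' act' Q' H' comp' size' acth'
    (gr : @graded_action F n V M act Q H comp size acth)
    (gr' : @graded_action F n W M' act' Q' H' comp' size' acth')
    (phi : V -> W) (d : nat) :
  {morph phi : x y / x + y} ->
  (forall b, Q b -> Q' (d + b)%N) ->
  (forall b x, Q b -> H b x -> H' (d + b)%N (phi x)) ->
  (forall c b f x, f \is c.-homog -> Q b -> H b x ->
     phi (acth c b f x) = acth' c (d + b)%N f (phi x)) ->
  is_module_hom M act M' act' phi.
Proof.
move=> phiD QQ' phiH phi_act.
have phi0 : phi 0 = 0 by apply: (addrI (phi 0)); rewrite -phiD !addr0.
split=> [x|x y _ _|f x Mx]; last 1 first.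
- elim/mpoly_homog_ind: f => [f g Hf Hg|c f fc].
    by rewrite (gr_actDl gr) (gr_actDl gr') phiD Hf Hg.
  elim/(gr_ind gr): x / Mx => [|x y Hx Hy|b x Qb xb].
  + by rewrite (gr_act0r gr) phi0 (gr_act0r gr').
  + by rewrite (gr_actDr gr) !phiD (gr_actDr gr') Hx Hy.
  + by rewrite (gr_act_homog gr fc Qb xb) (gr_act_homog gr' fc (QQ' _ Qb) (phiH _ _ Qb xb)) phi_act.
- elim/(gr_ind gr) => {x} [|x y Hx Hy|b x Qb xb]; first by rewrite phi0; exact: (gr_M0 gr').
    by rewrite phiD; apply: (gr_MD gr').
  by apply: (gr_HM gr' (QQ' _ Qb)); apply: phiH.
- exact: phiD.
Qed.

(** * The twisted actions *)

Section Instances.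
Variables (F : numFieldType) (n : nat).
Implicit Types (f g p q : {mpoly F[n]}) (s t u w : diffForm F n) (X Y : vectField F n).
Implicit Types (i j : 'I_n) (I J K : {set 'I_n}) (a b c e r : nat).

Lemma mcoeff_pihomog c p m : (pihomog mdeg c p)@_m = if mdeg m == c then p@_m else 0.
Proof.
rewrite pihomogE raddf_sum /= big_mkcond /=.
under eq_bigr => m' _.
  rewrite (_ : (if _ then _ else _) = (if mdeg m == c then (p@_m' *: 'X_[m'])@_m else 0)).
    over.
  rewrite mcoeffZ mcoeffX; case: (m' =P m) => [->//|_].
  by rewrite mulr0; case: ifP; case: ifP.
by case: ifP => _; [rewrite [in RHS](mpolyE p) raddf_sum|rewrite big1].
Qed.

(** A monomial has a single degree [d], so summing its coefficient over the homogeneous components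
    picks it up once. *)
Lemma sum_pick (V : nmodType) (x : V) (d N : nat) (Q : pred nat) :
  (x != 0 -> (d < N)%N && Q d) -> \sum_(b < N | Q b) (if d == b then x else 0) = x.
Proof.
have [-> _|_ /(_ isT) /andP[dN Qd]] := eqVneq x 0.
  by rewrite big1 // => b _; case: ifP.
rewrite (bigD1 (Ordinal dN)) //= eqxx big1 ?addr0 // => b /andP[_ bd].
by case: eqP => // E; case/eqP: bd; apply: val_inj.
Qed.

Lemma vcompE b X i m :
  (vcomp b%:Z X i)@_m = if (mdeg m == b.+1)%N then (X i)@_m else 0.
Proof. by rewrite ffunE addrC mcoeff_pihomog. Qed.

Lemma fcompE b t I m :
  (fcomp b t I)@_m = if (mdeg m + #|I| == b)%N then (t I)@_m else 0.
Proof.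
rewrite ffunE; case: leqP => Ib.
  by rewrite mcoeff_pihomog; congr (if _ then _ else _); lia.
by rewrite mcoeff0; case: eqP => //; lia.
Qed.

Lemma vscaleDl f g X : vscale (f + g) X = vscale f X + vscale g X.
Proof. by apply/ffunP => i; rewrite !ffunE mulrDl. Qed.

Lemma vscaleDr f X Y : vscale f (X + Y) = vscale f X + vscale f Y.
Proof. by apply/ffunP => i; rewrite !ffunE mulrDr. Qed.

Lemma vscaleZr k f X : vscale f (k *: X) = k *: vscale f X.
Proof. by apply/ffunP => i; rewrite !ffunE scalerAr. Qed.

Lemma vscaleA f g X : vscale f (vscale g X) = vscale (f * g) X.
Proof. by apply/ffunP => i; rewrite !ffunE mulrA. Qed.

Lemma graded_actT : @graded_action F n (vectField F n) (TTri F n) (actT F n)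
  (leq 1) (fun b => vhom b%:Z) (fun b => vcomp b%:Z) (@vsize F n) (@actT_hom F n).
Proof.
split.
- move=> f X; apply: eq_bigr => c _; rewrite big_geq_mkord.
  by apply: eq_bigl => b.
- by move=> b _; apply/ffunP => i; rewrite !ffunE; case: (b + 1) => // e; rewrite pihomog0.
- move=> X Y XM YM b b1; apply/ffunP => i.
  have /ffunP/(_ i) := XM b b1; have /ffunP/(_ i) := YM b b1; rewrite !ffunE.
  by case: (b + 1) => // e; rewrite pihomogB => -> ->; rewrite subr0.
- move=> b X Y; apply/ffunP => i; rewrite !ffunE.
  by case: (b%:Z + 1) => [e|e]; rewrite ?pihomogB ?subr0.
- move=> b X Xb; apply/ffunP => i; apply/mpolyP => m; rewrite vcompE ffunE mcoeff0.
  case: eqP => // mb; apply: memN_msupp_eq0; apply: msize_mdeg_ge; rewrite mb.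
  by apply: leq_trans (leq_trans Xb (leqnSn _)); apply: (leq_bigmax i).
- move=> X XM; apply/ffunP => i; apply/mpolyP => m.
  rewrite sum_ffunE raddf_sum /=; under eq_bigr do rewrite vcompE.
  rewrite (eq_bigr (fun b : 'I__ => if (mdeg m).-1 == b then (X i)@_m else 0)); last first.
    by move=> b b1; congr (if _ then _ else _); lia.
  rewrite sum_pick // => nz.
  (* Otherwise the component of degree [mdeg m - 1 < 1] would be nonzero, against membership in
     [TTri]. *)
  have m1 : (1 < mdeg m)%N.
    rewrite ltnNge; apply: contra nz => m1.
    have /ffunP/(_ i) : vcomp ((mdeg m)%:Z - 1) X = 0 by apply: XM; lia.
    rewrite !ffunE subrK => /mpolyP/(_ m).
    by rewrite mcoeff_pihomog eqxx mcoeff0 => ->.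
  have : (mdeg m < vsize X)%N.
    apply: leq_trans (leq_bigmax i).
    by apply: msize_mdeg_lt; rewrite mcoeff_msupp.
  by move: m1; lia.
- move=> b X _ b1 i m; rewrite vcompE; case: ifP => [/eqP -> _|_]; last by rewrite eqxx.
  by rewrite -addn1.
- move=> b b' X Xb; apply/ffunP => i; apply/mpolyP => m; rewrite vcompE.
  rewrite (_ : (if b' == b then X else 0) i = if b' == b then X i else 0); last first.
    by case: ifP; rewrite ?ffunE.
  have [E|/(Xb i m) mb] := eqVneq (X i)@_m 0.
    by case: ifP; case: ifP; rewrite ?E ?mcoeff0.
  have -> : (mdeg m == b'.+1) = (b' == b) by apply/eqP/eqP; lia.
  by case: ifP; rewrite ?mcoeff0.
- move=> b X b1 Xb b' b'1; apply/ffunP => i; rewrite !ffunE.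
  case be: (b' + 1) => [e|//]; apply/mpolyP => m; rewrite mcoeff_pihomog mcoeff0.
  case: eqP => // me; apply/eqP/negPn/negP => /(Xb i m) mb.
  by lia.
- by move=> c b X f g; rewrite /actT_hom vscaleDl scalerDr.
- by move=> c b f X Y; rewrite /actT_hom vscaleDr scalerDr.
- by move=> c b b1; apply: leq_trans b1 (leq_addl _ _).
- move=> c b f X /phom_homog fc b1 Xb i; rewrite !ffunE; apply: phomZ.
  by rewrite PoszD -addrA; apply: phomM.
- move=> c e b f g X fc ge b1 Xb.
  (* The factors [b / (b + e)] and [(b + e) / (b + e + c)] telescope. *)
  rewrite /actT_hom vscaleZr scalerA vscaleA; congr (_ *: _).
  have nz k : (b + k)%:R != 0 :> F by rewrite pnatr_eq0 -lt0n addn_gt0 b1.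
  have := nz 0%N; have := nz e; have := nz (c + e)%N; rewrite addn0 !natrD => h1 h2 h3.
  by field; rewrite h1 h2.
- move=> b k X b1 _; rewrite /actT_hom addr0 divff ?scale1r; last by rewrite pnatr_eq0 -lt0n.
  by apply/ffunP => i; rewrite !ffunE mul_mpolyC.
Qed.

(** The condition on degrees becomes an inequality of natural numbers, which [lia] can treat. *)
Lemma kappa_lt r a b : (kappa F r * a%:R < b%:R) = (r.+1 * a < b.*2)%N.
Proof.
rewrite /kappa natr1 mulrAC ltr_pdivrMr ?ltr0n //.
by rewrite -natrM -natrM ltr_nat muln2.
Qed.

Lemma actOmega_den_neq0 a r b c : kappa F r * a%:R < b%:R ->
  b%:R - kappa F r * a%:R + c%:R != 0.
Proof. by move=> Qb; rewrite lt0r_neq0 // ltr_wpDr ?ler0n // subr_gt0. Qed.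

Lemma actOmega_homE a r c b f t : actOmega_hom a r c b f t =
  (b%:R - kappa F r * a%:R + c%:R)^-1 *:
    ((b%:R - kappa F r * a%:R) *: fscale f t + wedge (dfun f) (contract (radial F n) t)).
Proof. by rewrite /actOmega_hom addrAC. Qed.

Lemma contractK X t : contract X (contract X t) = 0.
Proof. by apply: opp_eq0; rewrite {1}contractC. Qed.

Lemma contract_radial_wedge_dfun c f t : f \is c.-homog ->
  contract (radial F n) (wedge (dfun f) t) =
  c%:R *: fscale f t - wedge (dfun f) (contract (radial F n) t).
Proof.
move=> /phom_homog /euler E; rewrite contract_wedge_dfun; congr (_ - _).
by under eq_bigr do rewrite ffunE; rewrite E fscaleZl.
Qed.

(** By Euler's identity i_R(df) = c f, so the second summand contributes c f i_R t. With m = b -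
    kappa(r) a, the total factor m + c cancels the denominator. *)
Lemma contract_actOmega_hom a r c b f t : kappa F r * a%:R < b%:R -> f \is c.-homog ->
  contract (radial F n) (actOmega_hom a r c b f t) = fscale f (contract (radial F n) t).
Proof.
move=> Qb fc; rewrite actOmega_homE linearZ /= raddfD /= linearZ /= contract_fscale.
rewrite (contract_radial_wedge_dfun _ fc) contractK raddf0 subr0 -scalerDl scalerA.
by rewrite mulVf ?scale1r //; apply: actOmega_den_neq0.
Qed.

Lemma dfunM f g : dfun (f * g) = fscale f (dfun g) + fscale g (dfun f).
Proof.
rewrite /dfun !raddf_sum -big_split; apply: eq_bigr => i _ /=.
by rewrite mderivM fscaleDl !fscaleA addrC [g * _]mulrC.
Qed.

Lemma Omega_wedge_contract r f X t : Omega r t -> Omega r (wedge (dfun f) (contract X t)).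
Proof.
(* For [r = 0] the count through [r.-1] would give form degree 1, so that case uses the vanishing of
   the contraction. *)
case: r => [t0|r tr]; first by rewrite contract_Omega0 // raddf0; exact: Omega0.
by apply: (Omega_wedge (Omega_dfun f)); apply: Omega_contract tr.
Qed.

Lemma graded_actOmega a r : @graded_action F n (diffForm F n) (OmegaTri F n a r)
  (actOmega F n a r) (fun b => kappa F r * a%:R < b%:R)
  (fun b t => Omega r t /\ fhom b%:Z t) (@fcomp F n) (@fsize F n) (@actOmega_hom F n a r).
Proof.
split.
- by [].
- split; first exact: Omega0.
  by move=> b _; apply/ffunP => I; rewrite !ffunE; case: ifP; rewrite ?pihomog0.
- move=> s t [sr sM] [tr tM]; split; first by apply: OmegaD => //; apply: OmegaN.
  move=> b Qb; apply/ffunP => I; apply/mpolyP => m; rewrite fcompE !ffunE mcoeffB.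
  have := fcompE b s I m; have := fcompE b t I m; rewrite sM // tM // !ffunE mcoeff0.
  by case: ifP => // _ <- <-; rewrite subr0.
- move=> b s t; apply/ffunP => I; rewrite !ffunE.
  by case: ifP; rewrite ?pihomogB ?subr0.
- move=> b t tb; apply/ffunP => I; apply/mpolyP => m; rewrite fcompE ffunE mcoeff0.
  case: eqP => // mb; apply: memN_msupp_eq0; apply: msize_mdeg_ge.
  rewrite -(leq_add2r #|I|) mb; apply: leq_trans tb.
  exact: (leq_bigmax I).
- move=> t [tr tM]; apply/ffunP => I; apply/mpolyP => m.
  rewrite sum_ffunE raddf_sum /=; under eq_bigr do rewrite fcompE.
  rewrite (@sum_pick _ _ _ _ (fun b => kappa F r * a%:R < b%:R)) // => nz.
  apply/andP; split.
    apply: leq_trans (leq_bigmax I); rewrite ltn_add2r.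
    by apply: msize_mdeg_lt; rewrite mcoeff_msupp.
  apply/negPn/negP => /tM /ffunP/(_ I) /mpolyP/(_ m).
  by rewrite fcompE eqxx ffunE mcoeff0; apply/eqP.
- move=> b t [tr _] _; split.
    by move=> I Ir; rewrite ffunE tr // pihomog0; case: ifP.
  move=> I m; rewrite fcompE; case: ifP => [/eqP <- _|_]; last by rewrite eqxx.
  by rewrite PoszD addrK.
- move=> b b' t [_ tb]; apply/ffunP => I; apply/mpolyP => m; rewrite fcompE.
  rewrite (_ : (if b' == b then t else 0) I = if b' == b then t I else 0); last first.
    by case: ifP; rewrite ?ffunE.
  have [E|/(tb I m) mb] := eqVneq (t I)@_m 0.
    by case: ifP; case: ifP; rewrite ?E ?mcoeff0.
  have -> : (mdeg m + #|I| == b')%N = (b' == b) by apply/eqP/eqP; lia.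
  by case: ifP; rewrite ?mcoeff0.
- move=> b t Qb [tr tb]; split=> // b' Qb'; apply/ffunP => I; apply/mpolyP => m.
  rewrite fcompE ffunE mcoeff0; case: eqP => // mb'; apply/eqP/negPn/negP => /(tb I m) mb.
  have E : b' = b by lia.
  by rewrite E Qb in Qb'.
- by move=> c b t f g; rewrite /actOmega_hom dfunD fscaleDl wedgeDl
    [_ *: (fscale _ _ + _)]scalerDr addrACA scalerDr.
- by move=> c b f s t; rewrite /actOmega_hom contractDr wedgeDr fscaleDr
    [_ *: (fscale _ _ + _)]scalerDr addrACA scalerDr.
- by move=> c b; rewrite !kappa_lt; lia.
- move=> c b f t fc Qb [tr tb]; split; rewrite actOmega_homE.
    by apply/OmegaZ/OmegaD; [apply/OmegaZ/Omega_fscale|apply: Omega_wedge_contract].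
  move/phom_homog: fc => fc; rewrite PoszD; apply/fhomZ/fhomD.
    exact/fhomZ/fhom_fscale.
  by apply: fhom_wedge; [apply: fhom_dfun|apply: fhom_radial].
- move=> c e b f g t fc ge Qb _.
  have nz := actOmega_den_neq0 _ Qb.
  (* The inner contraction is [g] times i_R t, and the outer factor m + e cancels the inner
     denominator; what remains is the product rule for d(fg). *)
  rewrite [LHS]actOmega_homE contract_actOmega_hom // !actOmega_homE.
  have -> : (e + b)%:R - kappa F r * a%:R = b%:R - kappa F r * a%:R + e%:R :> F.
    by rewrite natrD; ring.
  rewrite linearZ /= scalerA divff // scale1r -addrA -natrD [(e + c)%N]addnC; congr (_ *: _).
  rewrite raddfD /= linearZ /= fscaleA -addrA; congr (_ + _).
  by rewrite dfunM wedgeDl !wedge_fscale wedge_fscaler.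
- move=> b k t Qb _; rewrite actOmega_homE.
  have -> : dfun k%:MP = 0 :> diffForm F n.
    by rewrite /dfun big1 // => i _; rewrite mderivC fscale0l.
  rewrite wedge0l !addr0 scalerA mulVf; last by have := actOmega_den_neq0 0 Qb; rewrite addr0.
  by rewrite scale1r; apply/ffunP => I; rewrite !ffunE mul_mpolyC.
Qed.

End Instances.

(** * The complex *)

Section Complex.
Variables (F : numFieldType) (n a : nat) (w : diffForm F n).
Hypotheses (w_hom : Omega_hom 1 a w) (w_rad : contract (radial F n) w = 0).
Implicit Types (f g p q : {mpoly F[n]}) (s t u : diffForm F n) (X Y : vectField F n).
Local Notation iR := (contract (radial F n)).

Let w1 : Omega 1 w := proj1 w_hom.

Let wa : fhom a%:Z w.
Proof.
move=> I m; rewrite -(proj2 w_hom) fcompE; case: ifP => [/eqP <- _|_]; last by rewrite eqxx.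
by rewrite PoszD addrK.
Qed.

Let sgf_w : sgf w = - w.
Proof. by rewrite (sgf_Omega w1) expr1 scaleN1r. Qed.

Let sgf_extd_w : sgf (extd w) = extd w.
Proof. by rewrite (sgf_Omega (Omega_extd w1)) -signr_odd scale1r. Qed.

Let iR_extd_w : iR (extd w) = a%:R *: w.
Proof. by have := cartan_radial wa; rewrite w_rad raddf0 addr0. Qed.

Lemma wedge_dfunC f t : wedge w (wedge (dfun f) t) = - wedge (dfun f) (wedge w t).
Proof. by rewrite (wedge_CA _ _ (Omega_dfun f)) sgf_w wedgeNl wedgeNr. Qed.

Lemma wedge_extd_dfunC f t :
  wedge (extd w) (wedge (dfun f) t) = wedge (dfun f) (wedge (extd w) t).
Proof. by rewrite (wedge_CA _ _ (Omega_dfun f)) sgf_extd_w. Qed.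

Lemma triD r : {morph tri r w : s t / s + t}.
Proof.
by move=> s t; rewrite /tri extdD !wedgeDr scalerDr addrACA.
Qed.

Lemma triZ r k t : tri r w (k *: t) = k *: tri r w t.
Proof.
by rewrite /tri extdZ !wedgeZr scalerDr !scalerA [k * _]mulrC.
Qed.

(** The failure of ordinary linearity comes from d(ft) alone; its sign is that of exchanging the
    one-forms [w] and df. *)
Lemma tri_fscale r f t :
  tri r w (fscale f t) = fscale f (tri r w t) - wedge (dfun f) (wedge w t).
Proof.
rewrite /tri extd_fscale wedgeDr wedge_dfunC !wedge_fscaler fscaleDr fscaleZr.
by rewrite -addrA addrC.
Qed.

(** The signs from d(df /\ t) and from exchanging [w] with df cancel; [extd w] is even and commutes
    with df. *)
Lemma tri_wedge_dfun r f t : tri r w (wedge (dfun f) t) = wedge (dfun f) (tri r w t).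
Proof.
rewrite /tri extd_wedge_dfun wedgeNr wedge_dfunC opprK wedge_extd_dfunC.
by rewrite wedgeDr wedgeZr.
Qed.

(** The antiderivation rule is applied to both terms, with i_R w = 0, i_R dw = a w and i_R dt = b t
    - d(i_R t). *)
Lemma contract_tri r (b : int) t : fhom b t ->
  iR (tri r w t) = tri r w (iR t) - (b%:~R - kappa F r * a%:R) *: wedge w t.
Proof.
move=> /cartan_radial E; rewrite /tri contractDr contractZr !contract_wedge.
rewrite w_rad wedge0l add0r sgf_w wedgeNl sgf_extd_w iR_extd_w.
have -> : iR (extd t) = b%:~R *: t - extd (iR t) by rewrite -E addrK.
rewrite wedgeDr wedgeZr wedgeNr wedgeZl scalerDr scalerA scalerBl !opprB.
by rewrite [X in _ + X = _]addrC addrACA; congr (_ + _); exact: addrC.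
Qed.

Lemma Omega_tri r t : Omega r t -> Omega r.+2 (tri r w t).
Proof.
move=> tr; apply: OmegaD; first exact: (Omega_wedge w1 (Omega_extd tr)).
exact/OmegaZ/(Omega_wedge (Omega_extd w1) tr).
Qed.

Lemma fhom_tri r b t : fhom b t -> fhom (a%:Z + b) (tri r w t).
Proof.
move=> tb; apply: fhomD; first by apply: fhom_wedge wa _; apply: fhom_extd.
by apply: fhomZ; apply: fhom_wedge tb; apply: fhom_extd.
Qed.

(** The increase by 1 compensates the degree [a] of [w], so that b - kappa(r) a stays constant along
    the complex. *)
Lemma kappaS r : kappa F r.+2 = kappa F r + 1.
Proof. by rewrite /kappa -!natr1; field. Qed.

Lemma kappa1 : kappa F 1 = 1.
Proof. by rewrite /kappa natr1 divff ?pnatr_eq0. Qed.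

Lemma tri_module_hom r :
  is_module_hom (OmegaTri F n a r) (actOmega F n a r)
    (OmegaTri F n a r.+2) (actOmega F n a r.+2) (tri r w).
Proof.
apply: (graded_module_hom (graded_actOmega F n a r) (graded_actOmega F n a r.+2) (d := a)).
- exact: triD.
- by move=> b; rewrite !kappa_lt; lia.
- by move=> b t _ [tr tb]; split; [apply: Omega_tri|rewrite PoszD; apply: fhom_tri].
- move=> c b f t fc Qb [tr tb]; rewrite !actOmega_homE triZ.
  have -> : (a + b)%:R - kappa F r.+2 * a%:R = b%:R - kappa F r * a%:R :> F.
    by rewrite kappaS natrD; ring.
  (* The defect -m df /\ w /\ t from [tri_fscale] is exactly what [contract_tri] produces in the
     target action. *)
  congr (_ *: _); rewrite triD triZ tri_fscale tri_wedge_dfun (contract_tri _ tb).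
  rewrite wedgeDr wedgeNr wedgeZr scalerBr.
  by rewrite -!addrA; congr (_ + _); rewrite addrC.
Qed.

Lemma triTD : {morph triT w : X Y / X + Y}.
Proof. by move=> X Y; rewrite /triT !contractDl extdD addrACA. Qed.

Lemma vscaleC k X : k *: X = vscale k%:MP X.
Proof. by apply/ffunP => i; rewrite !ffunE mul_mpolyC. Qed.

Lemma triT_vscale f X :
  triT w (vscale f X) = fscale f (triT w X) + wedge (dfun f) (contract X w).
Proof.
by rewrite /triT !contract_vscale extd_fscale fscaleDr [wedge _ _ + _]addrC addrA.
Qed.

(** The term i_X dw contributes -a i_X w. The function i_X w has degree b + a, so its differential
    contributes (b + a) i_X w. *)
Lemma contract_triT (b : int) X : vhom b X -> iR (triT w X) = b%:~R *: contract X w.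
Proof.
move=> Xb; rewrite /triT contractDr contractC iR_extd_w contractZr.
have X0 : Omega 0 (contract X w) by exact: Omega_contract w1.
have := cartan_radial (fhom_contract Xb wa).
rewrite [iR (contract X w)]contract_Omega0 // raddf0 addr0 => ->.
by rewrite -scaleNr -scalerDl rmorphD /= addrCA addNr addr0.
Qed.

Lemma triT_module_hom :
  is_module_hom (TTri F n) (actT F n) (OmegaTri F n a 1) (actOmega F n a 1) (triT w).
Proof.
apply: (graded_module_hom (graded_actT F n) (graded_actOmega F n a 1) (d := a)).
- exact: triTD.
- by move=> b b1; rewrite kappa_lt; lia.
- move=> b X b1 Xb; split.
    apply: OmegaD; first exact: Omega_contract (Omega_extd w1).
    exact/Omega_extd/(Omega_contract X w1).
  rewrite PoszD addrC; apply: fhomD; first by apply: fhom_contract Xb _; apply: fhom_extd.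
  by apply/fhom_extd/fhom_contract.
- move=> c b f X fc b1 Xb; rewrite actOmega_homE /actT_hom.
  (* As kappa(1) = 1, the shifted degree in the target is [b] and the denominators agree. The
     numerator [b] is then common to both terms by [contract_triT]. *)
  have -> : (a + b)%:R - kappa F 1 * a%:R = b%:R :> F by rewrite kappa1 natrD; ring.
  rewrite (contract_triT Xb) vscaleC vscaleA triT_vscale.
  rewrite mul_mpolyC fscaleZl dfunZ wedgeZl -scalerDr wedgeZr -scalerDr scalerA.
  by rewrite [X in X *: _ = _]mulrC.
Qed.

(** * Composition of consecutive differentials *)

Hypothesis w_int : wedge w (extd w) = 0.

(** Differentiating w /\ dw = 0 leaves only dw /\ dw, because d(dw) = 0. *)
Lemma wedge_extd_sq : wedge (extd w) (extd w) = 0.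
Proof.
have := extd_wedge w (extd w).
by rewrite w_int raddf0 extdK raddf0 addr0.
Qed.

Lemma wedge_extd_w t : wedge (extd w) (wedge w t) = 0.
Proof. by rewrite (wedge_CA _ _ w1) sgf_extd_w wedgeA w_int wedge0l. Qed.

(** Since d(w tri t) is a multiple of dw /\ dt, every term contains w /\ dw, up to order, or dw /\
    dw. *)
Lemma tri_tri r r' t : tri r' w (tri r w t) = 0.
Proof.
have ww u : wedge w (wedge (extd w) u) = 0 by rewrite wedgeA w_int wedge0l.
have dd u : wedge (extd w) (wedge (extd w) u) = 0 by rewrite wedgeA wedge_extd_sq wedge0l.
rewrite /tri extdD extdZ !extd_wedge !extdK wedge0l sgf_extd_w raddf0 addr0 add0r.
by rewrite !(wedgeDr, wedgeZr) !ww !dd wedge_extd_w !(scaler0, addr0).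
Qed.

(* The differential of L_X w is L_X (w /\ dw), up to the vanishing term
   dw /\ i_X dw, half of i_X (dw /\ dw). *)
Lemma tri_triT X : tri 1 w (triT w X) = 0.
Proof.
have B0 : Omega 0 (contract X w) by exact: Omega_contract w1.
have A1 : Omega 1 (contract X (extd w)) by exact: Omega_contract (Omega_extd w1).
have dwA : wedge (extd w) (contract X (extd w)) = 0.
  apply: opp_eq0; apply/eqP; rewrite -addr_eq0 {1}(wedgeC1 _ A1) sgf_extd_w.
  have := contract_wedge X (extd w) (extd w).
  by rewrite wedge_extd_sq raddf0 sgf_extd_w => <-.
(* This is the contraction of w /\ dw = 0 with [X]. *)
have BA : wedge (contract X w) (extd w) = wedge w (contract X (extd w)).
  apply/eqP; rewrite -subr_eq0; have := contract_wedge X w (extd w).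
  by rewrite w_int raddf0 sgf_w wedgeNl => <-.
(* Differentiating [BA] gives d(i_X w) /\ dw = - w /\ d(i_X dw), so the two surviving terms of the
   goal cancel. *)
have := congr1 (@extd F n) BA; rewrite !extd_wedge extdK raddf0 addr0 sgf_w wedgeNl dwA.
rewrite sub0r => dBdw.
rewrite /tri /triT kappa1 scale1r extdD extdK addr0 wedgeDr dwA add0r.
by rewrite (wedgeC1 _ (Omega_extd B0)) sgf_extd_w dBdw addrN.
Qed.

End Complex.

(** * Finite generation *)

Section FiniteGeneration.
Variables (F : numFieldType) (n : nat).
Implicit Types (f g p q : {mpoly F[n]}) (s t u : diffForm F n) (X Y : vectField F n).
Implicit Types (i j : 'I_n) (I J K : {set 'I_n}) (a b c e r : nat).

Lemma euler_form r (b : int) t : Omega r t -> fhom b t ->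
  \sum_i fscale 'X_i (pd i t) = (b - r%:Z)%:~R *: t.
Proof.
move=> tr tb; apply/ffunP => I; rewrite sum_ffunE ffunE.
under eq_bigr do rewrite !ffunE.
have [<-|/tr ->] := eqVneq #|I| r; first exact: euler.
by rewrite scaler0 big1 // => i _; rewrite mderiv0 mulr0.
Qed.

Lemma phom_msize (d : int) (k : nat) p : phom d p -> d <= k%:Z -> (msize p <= k.+1)%N.
Proof.
move=> pd dk; rewrite msizeE; apply/bigmax_leqP_seq => m; rewrite mcoeff_msupp => /pd mp _.
by rewrite ltnS; lia.
Qed.

Lemma fin_gen_Omega a r : fin_gen (OmegaTri F n a r) (actOmega F n a r).
Proof.
(* From degree [B] on, both kappa(r) a < b and r < b hold: the first admits every such degree, the
   second allows division by b + 1 - r and b - r. *)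
pose B := (r.+1 * a + r.+1)%N.
(* Pairs of inadmissible degree, or with a set of the wrong size, are sent to 0, so that the index
   type is a plain finite product. *)
pose gen (k : 'X_{1..n < B.+1} * {set 'I_n}) : diffForm F n :=
  if (kappa F r * a%:R < (mdeg k.1 + #|k.2|)%:R) && (#|k.2| == r)
  then fscale 'X_[k.1] (dx F k.2) else 0.
apply: (graded_fin_gen (graded_actOmega F n a r) (gen := gen) (B := B)).
- move=> [m I]; rewrite /gen /=; case: ifP => [/andP[Qm /eqP Ir]|_]; last first.
    exact: (gr_M0 (graded_actOmega F n a r)).
  have dxI : fhom #|I|%:Z (dx F I).
    move=> J; rewrite ffunE; case: eqP => [->|_]; last exact: phom0.
    by rewrite subrr; apply/(@phom_homog _ _ 0%N); rewrite dhomog1.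
  apply: (gr_HM (graded_actOmega F n a r) Qm); split.
    apply: Omega_fscale => J Jr; rewrite ffunE.
    by case: eqP => // E; rewrite E Ir eqxx in Jr.
  rewrite PoszD; apply: fhom_fscale dxI.
  by apply/phom_homog; rewrite dhomogX.
- move=> b t bB Qb [tr tb]; exists (fun k : 'X_{1..n < B.+1} * {set 'I_n} => (t k.2)@_(k.1)).
  rewrite {1}(form_sum t).
  transitivity (\sum_(I : {set 'I_n}) \sum_(m : 'X_{1..n < B.+1}) (t I)@_m *: gen (m, I)).
    apply: eq_bigr => I _.
    have /mpolywE {1}-> : (msize (t I) <= B.+1)%N.
      by apply: phom_msize (tb I) _; lia.
    rewrite fscale_suml; apply: eq_bigr => m _; rewrite fscaleZl.
    have [->|nz] := eqVneq (t I)@_m 0; first by rewrite !scale0r.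
    have mI := tb I m nz.
    have Ir : #|I| = r.
      by apply/eqP; apply: contraTT nz => /tr ->; rewrite mcoeff0 eqxx.
    have -> : (t I)@_m *: gen (m, I) = (t I)@_m *: fscale 'X_[m] (dx F I); last by [].
    rewrite /gen /= Ir eqxx andbT.
    have -> : (mdeg m + r)%N = b by lia.
    by rewrite Qb.
  by rewrite exchange_big pair_big.
- by move=> b Bb; rewrite kappa_lt; rewrite /B in Bb; lia.
move=> b t Bb [tr tb].
have Qb : kappa F r * a%:R < b%:R by rewrite kappa_lt; rewrite /B in Bb; lia.
have rb : (r < b)%N by rewrite /B in Bb; lia.
set m := b%:R - kappa F r * a%:R.
have m0 : m != 0 by have := actOmega_den_neq0 0 Qb; rewrite addr0.
have m1 : m + 1 != 0 by exact: actOmega_den_neq0 1 Qb.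
(* These are the degrees of the coefficients of [t] and, in the next line, of [sg], whose form
   degree is r + 1; Euler's identity divides by them. *)
have br1 : (b.+1%:Z - r%:Z)%:~R != 0 :> F by rewrite intr_eq0; lia.
have br : (b.+1%:Z - r.+1%:Z)%:~R != 0 :> F by rewrite intr_eq0; lia.
have X1 i : 'X_i \is @ishomog1 n F 1 mdeg by rewrite dhomogX /= mdeg1.
pose th i := ((b.+1%:Z - r%:Z)%:~R)^-1 *: pd i t.
have tE : t = \sum_i fscale 'X_i (th i).
  transitivity (((b.+1%:Z - r%:Z)%:~R)^-1 *: \sum_i fscale 'X_i (pd i t)).
    by rewrite (euler_form tr tb) scalerA mulVf ?scale1r.
  by rewrite scaler_sumr; apply: eq_bigr => i _; rewrite fscaleZr.
pose z := t - \sum_i actOmega_hom a r 1 b 'X_i (th i).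
have thb i : Omega r (th i) /\ fhom b%:Z (th i).
  split; first exact/OmegaZ/Omega_pd.
  apply: fhomZ; have -> : b%:Z = b.+1%:Z - 1 by lia.
  exact: fhom_pd.
have [zr zb] : Omega r z /\ fhom b.+1%:Z z.
  have Hi i := gr_acth_in (graded_actOmega F n a r) (X1 i) Qb (thb i).
  split.
    apply: OmegaD => //; apply/OmegaN/Omega_sum => i _; exact: (proj1 (Hi i)).
  apply: fhomD => //; apply/fhomN/fhom_sum => i _; exact: (proj2 (Hi i)).
(* After contraction with the radial field the twisted action is ordinary multiplication, so [tE]
   gives the vanishing. *)
have z0 : contract (radial F n) z = 0.
  apply/eqP; rewrite /z raddfB /= subr_eq0 {1}tE !raddf_sum; apply/eqP.
  by apply: eq_bigr => i _ /=; rewrite contract_actOmega_hom // contract_fscale.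
pose sg := (b.+1%:R)^-1 *: extd z.
(* Cartan's formula for [z] reduces to i_R dz = (b + 1) z. *)
have zE : z = contract (radial F n) sg.
  have := cartan_radial zb; rewrite z0 raddf0 addr0 /sg contractZr => ->.
  by rewrite scalerA mulVf ?scale1r ?pnatr_eq0.
have sgr : Omega r.+1 sg by apply/OmegaZ/Omega_extd.
have sgb : fhom b.+1%:Z sg by apply/fhomZ/fhom_extd.
(* Contraction is linear over functions, so the Euler decomposition of [sg] carries over to [z]. *)
pose rho i := contract (radial F n) (((b.+1%:Z - r.+1%:Z)%:~R)^-1 *: pd i sg).
have zE' : z = \sum_i fscale 'X_i (rho i).
  rewrite zE; transitivity (contract (radial F n)
      (((b.+1%:Z - r.+1%:Z)%:~R)^-1 *: \sum_i fscale 'X_i (pd i sg))).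
    by rewrite (euler_form sgr sgb) scalerA mulVf ?scale1r.
  rewrite scaler_sumr raddf_sum; apply: eq_bigr => i _ /=.
  by rewrite -fscaleZr contract_fscale.
(* On [rho i], which i_R kills, ['X_i] acts with the factor m / (m + 1); the coefficient is its
   inverse. *)
exists (fun i => th i + ((m + 1) / m) *: rho i); split=> [i|].
  have [thr thb'] := thb i.
  split.
    apply: OmegaD => //; apply/OmegaZ.
    exact: (Omega_contract (radial F n) (OmegaZ _ (Omega_pd i sgr))).
  apply: fhomD => //; apply/fhomZ/fhom_radial/fhomZ.
  have -> : b%:Z = b.+1%:Z - 1 by lia.
  exact: fhom_pd.
under eq_bigr do rewrite (gr_acthDr (graded_actOmega F n a r)).
rewrite big_split /= -[LHS](subrK (\sum_i actOmega_hom a r 1 b 'X_i (th i))) addrC.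
congr (_ + _); rewrite -/z zE'; apply: eq_bigr => i _.
rewrite actOmega_homE contractZr /rho contractK scaler0 raddf0 addr0 -/(rho i).
rewrite -/m fscaleZr !scalerA -[LHS]scale1r; congr (_ *: _).
by field; rewrite m1 m0.
Qed.

(** On homogeneous fields the twisted action of a variable is ordinary multiplication up to a
    nonzero scalar, so Euler's identity on the coefficients suffices. *)
Lemma fin_gen_T : fin_gen (TTri F n) (actT F n).
Proof.
(* Fields of degree 1 have quadratic coefficients; monomials of degree 0 or 1 are assigned the field
   0. *)
pose gen (k : 'X_{1..n < 3} * 'I_n) : vectField F n :=
  if mdeg k.1 == 2 then [ffun j => if j == k.2 then 'X_[k.1] else 0] else 0.
apply: (graded_fin_gen (graded_actT F n) (gen := gen) (B := 1%N)) => [[m i]|b X b1 b1' Xb||].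
- rewrite /gen /=; case: eqP => [m2|_]; last exact: (gr_M0 (graded_actT F n)).
  apply: (gr_HM (graded_actT F n) (b := 1%N)) => // j; rewrite ffunE.
  by case: ifP => _; [apply/(@phom_homog _ _ 2%N); rewrite dhomogX /= m2|apply: phom0].
- have {}b1 : b = 1%N by lia.
  subst b; exists (fun k : 'X_{1..n < 3} * 'I_n => (X k.2)@_(k.1)).
  apply/ffunP => j; rewrite sum_ffunE.
  transitivity (\sum_(i < n) \sum_(m : 'X_{1..n < 3}) ((X i)@_m *: gen (m, i)) j); last first.
    by rewrite exchange_big pair_big.
  rewrite (bigD1 j) //= [X in _ + X]big1 ?addr0 => [|i ij]; last first.
    rewrite big1 // => m _; rewrite ffunE /gen /=.
    by case: ifP => _; rewrite !ffunE ?scaler0 // eq_sym (negPf ij) scaler0.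
  have /mpolywE {1}-> : (msize (X j) <= 3)%N by apply: phom_msize (Xb j) _.
  apply: eq_bigr => m _; rewrite ffunE.
  have [->|nz] := eqVneq (X j)@_m 0; first by rewrite !scale0r.
  have mj := Xb j m nz.
  have m2 : mdeg m = 2 by lia.
  by rewrite /gen /= m2 eqxx ffunE eqxx.
- by [].
move=> b X b1 Xb.
(* The coefficients of [X] have degree b + 2, hence the divisor from Euler's identity; (b + 1) / b
   cancels the factor of the action. *)
exists (fun i => ((b%:R + 1) / b%:R / b.+2%:R) *: [ffun j => mderiv i (X j)]); split=> [i j|].
  rewrite !ffunE; apply: phomZ; have -> : b%:Z + 1 = b.+1%:Z + 1 - 1 by lia.
  exact: phom_deriv.
apply/ffunP => j; rewrite sum_ffunE.
under eq_bigr do rewrite !ffunE -scalerAr scalerA.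
rewrite -scaler_sumr (euler (Xb j)) scalerA.
set k := (X in X *: _); suff -> : k = 1 by rewrite scale1r.
rewrite /k; have -> : (b.+1%:Z + 1)%:~R = b.+2%:R :> F.
  by rewrite -[b.+2%:R]/(b.+2%:Z%:~R); congr (_%:~R); lia.
have h0 : b%:R != 0 :> F by rewrite pnatr_eq0 -lt0n.
have h1 : b%:R + 1 != 0 :> F by rewrite natr1 pnatr_eq0.
have h2 : 2 + b%:R != 0 :> F by rewrite -natrD pnatr_eq0.
by field; rewrite h0 h1 h2.
Qed.

End FiniteGeneration.

Theorem proposition5p4 (R : realType) (n a : nat) (w : diffForm R[i] n)
    (w_hom : Omega_hom 1 a w)
    (w_rad : contract (radial R[i] n) w = 0)
    (w_int : wedge w (extd w) = 0) :
  (* the terms are S-modules *)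
  (is_module (TTri R[i] n) (actT R[i] n) /\
   forall r : nat, is_module (OmegaTri R[i] n a r) (actOmega R[i] n a r)) /\
  (* the differentials are S-linear *)
  (is_module_hom (TTri R[i] n) (actT R[i] n)
     (OmegaTri R[i] n a 1) (actOmega R[i] n a 1) (triT w) /\
   forall r : nat, odd r ->
     is_module_hom (OmegaTri R[i] n a r) (actOmega R[i] n a r)
       (OmegaTri R[i] n a r.+2) (actOmega R[i] n a r.+2) (tri r w)) /\
  (* consecutive differentials compose to zero *)
  ((forall X, TTri R[i] n X -> tri 1 w (triT w X) = 0) /\
   forall (r : nat) t, odd r -> OmegaTri R[i] n a r t -> tri r.+2 w (tri r w t) = 0) /\
  (* finite generation *)
  (fin_gen (TTri R[i] n) (actT R[i] n) /\
   forall r : nat, fin_gen (OmegaTri R[i] n a r) (actOmega R[i] n a r)).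

Proof.
split; first by split=> [|r]; [exact: graded_module (graded_actT _ n)
                              |exact: graded_module (graded_actOmega _ n a r)].
split; first by split=> [|r _]; [exact: triT_module_hom|exact: tri_module_hom].
split; first by split=> [X _|r t _ _]; [exact: (tri_triT w_hom)|exact: (tri_tri w_hom)].
by split=> [|r]; [exact: fin_gen_T|exact: fin_gen_Omega].
Qed.
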